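(* Let $\mathcal M\subset\mathbb Z^n$ be a minimal subgraph and let $\mathcal M^n$ be the set of vertices of $\mathcal M$ that are vertices of some unit $n$-cube all of whose $2^n$ vertices lie in $\mathcal M$. Then, equipping $\mathcal M$ and $\mathcal M^n$ with the metric induced from the graph distance $d$ of $\mathbb Z^n$, the inclusion $\mathcal M^n\subset\mathcal M$ is a rough isometry: it preserves distances and there is $c>0$ with $d(x,\mathcal M^n)\le c$ for all $x\in\mathcal M$. Moreover, there is a constant $c(n)>0$ depending only on $n$ such that for all sufficiently large $r$ and every $x\in\mathcal M$, $$\frac{|\mathcal M^n\cap\hat B_r(x)|}{|\mathcal M\cap\hat B_r(x)|}\ge c(n),\qquad \frac{|\delta\mathcal M^n\cap\hat B_r(x)|}{|\delta\mathcal M\cap\hat B_r(x)|}\ge\frac1{1+2n},$$ where $\hat B_r(x)=\{y:\max_{1\le i\le n}|y_i-x_i|\le r\}$.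
   Context: $\mathbb Z^n$ is the integer lattice graph ($x\sim y$ iff $|x-y|=1$). For $\Omega\subset\mathbb Z^n$: $\tau\Omega=\{z\notin\Omega:\exists w\in\Omega,z\sim w\}$, $\overline\Omega=\Omega\cup\tau\Omega$, $E_\Omega$ = edges $\{x,y\}$ with $x\in\Omega,y\in\overline\Omega$, $\partial K$ = edges with exactly one endpoint in $K$, and the vertex boundary $\delta\Omega=\{x\in\Omega: x\text{ has a neighbor not in }\Omega\}$. A proper nonempty $\mathcal M\subset\mathbb Z^n$ is minimal if for every finite $U$ and every $\hat K\subset\overline U$ with $\hat K\cap\tau U=\mathcal M\cap\tau U$, $|\partial\mathcal M\cap E_U|\le|\partial\hat K\cap E_U|$.
   Formalization: The second quotient bound is asserted only for those x and r for which δM ∩ B̂_r(x) is nonempty; otherwise the quotient is 0/0, as for a half-space and x at depth greater than r. *)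

(* Defs.v *)
From HB Require Import structures.
From mathcomp Require Import all_boot all_order all_algebra finmap.
From mathcomp Require Import zify.
From mathcomp Require Import boolp classical_sets cardinality reals ereal.

Set Implicit Arguments.
Unset Strict Implicit.
Unset Printing Implicit Defensive.

Import Order.TTheory GRing.Theory Num.Theory.

Local Open Scope classical_set_scope.
Local Open Scope ring_scope.

Definition zlat (n : nat) := 'rV[int]_n.

(* Over the integers |x - y| = 1 means x - y = +-e_i whichever l^p norm is
   used; this is the l^1 norm. *)
Definition adj n : rel (zlat n) :=
  fun x y => (\sum_(i < n) absz (x 0%R i - y 0%R i)%R)%N == 1%N.

Definition is_walk n (x y : zlat n) (k : nat) : Prop :=
  exists p : seq (zlat n), [/\ path (@adj n) x p, last x p = y & size p = k].

Lemma zlat_connected n (x y : zlat n) : exists k, `[< is_walk x y k >].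
Proof.
suff H m : forall x : zlat n, (\sum_(i < n) absz (x 0%R i - y 0%R i)%R)%N = m ->
    is_walk x y m by exists (\sum_(i < n) absz (x 0%R i - y 0%R i)%R)%N;
    apply/asboolP; exact: H.
elim: m => [|m IHm] {}x.
  move=> /eqP; rewrite sum_nat_eq0 => /forallP xy.
  exists [::]; split => //=; apply/rowP => i.
  by move: (xy i); rewrite /= absz_eq0 subr_eq0 => /eqP.
move=> sxy.
have [i xyi] : exists i, x 0 i != y 0 i.
  apply/existsP; rewrite -[X in is_true X]negbK; apply/negP => /existsPn xy.
  move: sxy; rewrite big1 // => i _.
  by move: (xy i); rewrite negbK => /eqP ->; rewrite subrr.
pose s : int := if x 0 i < y 0 i then 1 else -1.
pose x' : zlat n := \row_j (if j == i then x 0 i + s else x 0 j).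
have [|p [pp lp sp]] := IHm x'.
  move: sxy; rewrite (bigD1 i) //= [in X in _ -> X](bigD1 i) //=.
  rewrite mxE eqxx /s => sxy.
  under eq_bigr => j /negPf ji do rewrite mxE ji.
  by move: sxy xyi; set t := bigop _ _ _; case: ifP; lia.
exists (x' :: p); split => //=; last by rewrite sp.
rewrite pp andbT /adj (bigD1 i) //= big1 ?mxE ?eqxx ?addn0.
  by rewrite /s; case: ifP => _; apply/eqP; lia.
by move=> j /negPf ji; rewrite mxE ji subrr.
Qed.

Definition gdist n (x y : zlat n) : nat := ex_minn (zlat_connected x y).

(* Equal to +oo when A is empty. *)
Definition gdist_set (R : realType) n (x : zlat n) (A : set (zlat n)) : \bar R :=
  ereal_inf [set ((gdist x y)%:R)%:E | y in A].

(* Only meaningful for finite A (the value is 0 when A is infinite). *)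
Definition set_card (T : choiceType) (A : set T) : nat := #|` fset_set A|.

Definition outer_bd n (W : set (zlat n)) : set (zlat n) :=
  [set z | ~ W z /\ exists2 w, W w & adj z w].

Definition clos n (W : set (zlat n)) : set (zlat n) := W `|` outer_bd W.

Definition edges n (W : set (zlat n)) : set {fset (zlat n)} :=
  [set e | exists x y, [/\ W x, clos W y, adj x y & e = [fset x; y]%fset]].

Definition edge_bd n (K : set (zlat n)) : set {fset (zlat n)} :=
  [set e | exists x y, [/\ K x, ~ K y, adj x y & e = [fset x; y]%fset]].

Definition vertex_bd n (W : set (zlat n)) : set (zlat n) :=
  [set x | W x /\ exists2 y, ~ W y & adj x y].

Definition minimal n (M : set (zlat n)) : Prop :=
  [/\ M !=set0, M <> setT &
    forall U K : set (zlat n), finite_set U -> K `<=` clos U ->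
      K `&` outer_bd U = M `&` outer_bd U ->
      (set_card (edge_bd M `&` edges U) <= set_card (edge_bd K `&` edges U))%N].

(* The vertices of the unit n-cube whose least corner is z. *)
Definition unit_cube n (z : zlat n) : set (zlat n) :=
  [set x | forall i, x 0 i = z 0 i \/ x 0 i = z 0 i + 1].

Definition cube_part n (M : set (zlat n)) : set (zlat n) :=
  [set x | M x /\ exists2 z, unit_cube z x & unit_cube z `<=` M].

Definition cube_ball (R : realType) n (r : R) (x : zlat n) : set (zlat n) :=
  [set y | (\max_(i < n) absz (y 0%R i - x 0%R i)%R)%:R <= r].

Definition induced_dist (R : realType) n (A : set (zlat n)) (x y : A) : R :=
  (gdist (val x) (val y))%:R.

Lemma cube_part_sub n (M : set (zlat n)) : cube_part M `<=` M.
Proof. by move=> x []. Qed.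

Definition cube_part_incl n (M : set (zlat n)) (x : cube_part M) : M :=
  exist _ (val x) (mem_set (cube_part_sub (set_valP x))).

Definition rough_isometry (R : realType) (X Y : Type)
    (dX : X -> X -> R) (dY : Y -> Y -> R) (f : X -> Y) : Prop :=
  exists a b c : R, [/\ 1 <= a, 0 <= b, 0 < c,
    forall x x', a^-1 * dX x x' - b <= dY (f x) (f x') <= a * dX x x' + b &
    forall y, exists x, dY y (f x) <= c].

(* Main.v *)
(* A cube all of whose vertices lie in M exists near every point of M because M
   is fat while its boundary is thin: comparing M with M minus a cube and using
   the isoperimetric inequality of Z^n gives the volume growth |M ∩ B_r| >= c r^n,
   whereas the same comparison bounds the boundary edges in B_r by O(r^(n-1)),
   and every thin point (a point of M outside M^n) is at distance at most n from
   such an edge.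

   For the boundary ratio, removing the thin points of B_r from M shows that the
   thin points of the vertex boundary are at most n |δM^n ∩ B_r|, up to the thin
   points on the faces of B_r. These are negligible with respect to r^(n-1): by the
   divergence of the harmonic series some hyperplane at bounded distance T from
   the face carries few boundary edges, and replacing M by a cylinder over it in a
   slab of thickness 2T shows that M is almost cylindrical near the face, whereas
   a thin point witnesses the contrary. This settles the case where the complement
   of M fills a fixed proportion of B_r, since then |δM ∩ B_r| is of order r^(n-1).
   Otherwise one fills B_r \ M: on each line of the cube the new boundary is
   paid by old boundary unless the line avoids M altogether, and a thin point
   forces a defect in this balance, so that the thin points of B_r are at most
   C |B_r \ M| / r, a small fraction of |δM ∩ B_r| by isoperimetry. *)
Require Import Defs.
From mathcomp Require Import all_boot all_order all_algebra finmap.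
From mathcomp Require Import zify.
From mathcomp Require Import boolp classical_sets cardinality reals ereal.

Set Implicit Arguments.
Unset Strict Implicit.
Unset Printing Implicit Defensive.

Import Order.TTheory GRing.Theory Num.Theory.
Local Open Scope classical_set_scope.
Local Open Scope ring_scope.

(** * Counting in finite sets *)

Definition cnt (T : choiceType) (A : {fset T}) (P : pred T) : nat :=
  #|` [fset x in A | P x]%fset|.

Lemma leq_card_inj (T T' : choiceType) (A : {fset T}) (B : {fset T'}) (f : T -> T') :
  (forall x, x \in A -> f x \in B) -> {in A &, injective f} -> (#|` A| <= #|` B|)%N.
Proof.
move=> fAB fI; rewrite -(card_in_imfset imfset_key fI).
by apply/fsubset_leq_card/fsubsetP => _ /imfsetP[x /= xA ->]; exact: fAB.
Qed.

Lemma in_cnt (T : choiceType) (A : {fset T}) (P : pred T) x :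
  (x \in [fset x in A | P x]%fset) = (x \in A) && P x.
Proof. by rewrite !inE. Qed.

Lemma leq_cnt_inj (T T' : choiceType) (A : {fset T}) (B : {fset T'}) (P : pred T) (Q : pred T') (f : T -> T') :
  (forall x, x \in A -> P x -> (f x \in B) && Q (f x)) ->
  (forall x y, x \in A -> y \in A -> P x -> P y -> f x = f y -> x = y) ->
  (cnt A P <= cnt B Q)%N.
Proof.
move=> fAB fI; apply: (@leq_card_inj _ _ _ _ f) => [x | x y].
  by rewrite !in_cnt => /andP[]; apply: fAB.
by rewrite !in_cnt => /andP[xA Px] /andP[yA Py]; apply: fI.
Qed.

Lemma leq_cnt (T : choiceType) (A : {fset T}) (P Q : pred T) :
  (forall x, x \in A -> P x -> Q x) -> (cnt A P <= cnt A Q)%N.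
Proof. by move=> PQ; apply: (@leq_cnt_inj _ _ _ _ _ _ id) => // x xA Px; rewrite xA PQ. Qed.

Lemma eq_cnt (T : choiceType) (A : {fset T}) (P Q : pred T) :
  (forall x, x \in A -> P x = Q x) -> cnt A P = cnt A Q.
Proof. by move=> PQ; apply/eqP; rewrite eqn_leq !leq_cnt // => x /PQ ->. Qed.

Lemma leq_cnt_card (T : choiceType) (A : {fset T}) (P : pred T) : (cnt A P <= #|` A|)%N.
Proof. by apply/fsubset_leq_card/fsubsetP => x; rewrite in_cnt => /andP[]. Qed.

Lemma cnt_sum (T : choiceType) (A : {fset T}) (P : pred T) :
  cnt A P = (\sum_(x <- A) P x)%N.
Proof.
rewrite /cnt -big_mkcond /= -sum1_size.
rewrite -[RHS]big_filter; apply: perm_big; apply: uniq_perm.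
- exact: fset_uniq.
- by rewrite filter_uniq // fset_uniq.
- by move=> x; rewrite in_cnt mem_filter andbC.
Qed.

Lemma cntU (T : choiceType) (A : {fset T}) (P Q R : pred T) :
  (forall x, x \in A -> P x -> Q x || R x) -> (cnt A P <= cnt A Q + cnt A R)%N.
Proof.
move=> PQR; rewrite !cnt_sum -big_split /= big_seq [leqRHS]big_seq.
apply: leq_sum => x xA; move: (PQR x xA).
by case: (P x) (Q x) (R x) => [] [] [] // /(_ isT).
Qed.

Lemma cntID (T : choiceType) (A : {fset T}) (P Q : pred T) :
  cnt A P = (cnt A (fun x => P x && Q x) + cnt A (fun x => P x && ~~ Q x))%N.
Proof.
rewrite !cnt_sum -big_split /=.
by apply: eq_bigr => x _; case: (P x) (Q x) => [] [].
Qed.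

(** A union bound over [K]: the concatenated lists of images under the [f k] cover the counted
    set. *)
Lemma leq_cnt_cover (K : finType) (T T' : choiceType) (A : {fset T})
    (B : K -> {fset T'}) (P : pred T) (Q : K -> pred T') (f : K -> T' -> T) :
  (forall x, x \in A -> P x -> exists k y, [/\ y \in B k, Q k y & x = f k y]) ->
  (cnt A P <= \sum_(k : K) cnt (B k) (Q k))%N.
Proof.
move=> cov.
have -> : (\sum_(k : K) cnt (B k) (Q k))%N =
    size (flatten [seq [seq f k y | y <- [fset y in B k | Q k y]%fset] | k <- index_enum K]).
  rewrite size_flatten /shape -map_comp sumnE big_map.
  by apply: eq_bigr => k _; rewrite /= size_map.
apply: uniq_leq_size; first exact: fset_uniq.
move=> x; rewrite in_cnt => /andP[xA Px]; have [k [y [yB Qy ->]]] := cov x xA Px.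
apply/flattenP; exists [seq f k y | y <- [fset y in B k | Q k y]%fset].
  by apply/mapP; exists k => //; rewrite mem_index_enum.
by apply/mapP; exists y => //; rewrite in_cnt yB.
Qed.

(** Disjoint columns, one for each point of [W]; this is how a count on a hyperplane gains a factor
    of the side length. *)
Lemma leq_card_columns (T T' : choiceType) (W : {fset T}) (A : {fset T'}) (L : nat)
    (f : T -> 'I_L -> T') :
  (forall w j, w \in W -> f w j \in A) ->
  (forall w w' j j', w \in W -> w' \in W -> f w j = f w' j' -> w = w' /\ j = j') ->
  (#|` W| * L <= #|` A|)%N.
Proof.
move=> fA fI.
have -> : (#|` W| * L)%N = size [seq f w j | w <- W, j <- enum 'I_L].
  by rewrite size_allpairs size_enum_ord.
apply: uniq_leq_size.
  apply: allpairs_uniq; rewrite ?fset_uniq ?enum_uniq //.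
  move=> [w j] [w' j'] /allpairsP[[a b] [/= aW _ [-> ->]]].
  by move=> /allpairsP[[a' b'] [/= aW' _ [-> ->]]] /fI[] // -> ->.
by move=> _ /allpairsP[[w j] [/= wW _ ->]]; apply: fA.
Qed.

(** * Lattice directions and boxes *)

Notation dir n := ('I_n * bool)%type.

Definition sg (b : bool) : int := if b then 1 else -1.

Definition nb n (k : dir n) (x : zlat n) : zlat n :=
  \row_j (x 0 j + (if j == k.1 then sg k.2 else 0)).

Definition opp_dir n (k : dir n) : dir n := (k.1, ~~ k.2).

Lemma nbE n (k : dir n) (x : zlat n) j :
  nb k x 0 j = x 0 j + (if j == k.1 then sg k.2 else 0).
Proof. by rewrite mxE. Qed.

Lemma opp_dirK n : involutive (@opp_dir n).
Proof. by case=> i b; rewrite /opp_dir /= negbK. Qed.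

Lemma nbK n (k : dir n) : cancel (nb k) (nb (opp_dir k)).
Proof.
move=> x; apply/rowP => j; rewrite !nbE /=.
by case: (j == k.1); case: k.2; rewrite /sg /= ?addr0 ?addrK ?subrK ?addrNK.
Qed.

Lemma nbKV n (k : dir n) : cancel (nb (opp_dir k)) (nb k).
Proof. by move=> x; rewrite -{1}(opp_dirK k) nbK. Qed.

Lemma nb_inj n (k : dir n) : injective (nb k).
Proof. exact: can_inj (nbK k). Qed.

Lemma nb_inj_dir n (x : zlat n) (k k' : dir n) : nb k x = nb k' x -> k = k'.
Proof.
case: k k' => [i b] [i' b'] /rowP e.
have := e i; rewrite !nbE /= eqxx; case: eqP => [->|_]; first by case: b b' {e} => [] [] //; rewrite /sg /=; lia.
by case: b {e}; rewrite /sg /=; lia.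
Qed.

Lemma nb_neq n (x : zlat n) (k : dir n) : nb k x != x.
Proof. by apply/eqP => /rowP /(_ k.1); rewrite nbE eqxx; case: k.2; rewrite /sg /=; lia. Qed.

Lemma adjP n (x y : zlat n) : reflect (exists k, y = nb k x) (adj x y).
Proof.
apply: (iffP idP) => [|[k ->]]; last first.
  rewrite /adj (bigD1 k.1) //= big1 => [|j /negPf jk].
    by rewrite nbE eqxx; case: k.2; rewrite /sg /=; lia.
  by rewrite nbE jk addr0 subrr.
rewrite /adj => /eqP s1.
have [i xyi] : exists i, x 0 i != y 0 i.
  apply/existsP; rewrite -[X in is_true X]negbK; apply/negP => /existsPn xy.
  move: s1; rewrite big1 // => i _.
  by move: (xy i); rewrite negbK => /eqP ->; rewrite subrr.
move: s1; rewrite (bigD1 i) //=; set t := bigop _ _ _ => s1.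
have t0 : t = 0%N by move: s1 xyi; lia.
have ei j : j != i -> y 0 j = x 0 j.
  move=> ji; move/eqP: t0; rewrite sum_nat_eq0 => /forallP /(_ j).
  by rewrite ji /= => /eqP; lia.
exists (i, x 0 i < y 0 i); apply/rowP => j; rewrite nbE /=.
case: (eqVneq j i) => [->|/ei ->]; last by rewrite addr0.
by move: s1 xyi; rewrite t0 /sg; case: ifP; lia.
Qed.

Lemma adj_sym n (x y : zlat n) : adj x y = adj y x.
Proof. by rewrite /adj; congr (_ == _); apply: eq_bigr => i _; lia. Qed.

Definition shift_ffun n m (l : zlat n) (f : {ffun 'I_n -> 'I_m}) : zlat n :=
  \row_i (l 0 i + (f i : nat)%:Z).

Definition bx n (l : zlat n) (w : 'I_n -> nat) : {fset zlat n} :=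
  [fset shift_ffun l f | f in
    [pred f : {ffun 'I_n -> 'I_(\max_i w i)} | [forall i, (f i < w i)%N]]]%fset.

Lemma in_bx n (l : zlat n) (w : 'I_n -> nat) (y : zlat n) :
  reflect (forall i, l 0 i <= y 0 i < l 0 i + (w i)%:Z) (y \in bx l w).
Proof.
apply: (iffP idP) => [/imfsetP[f /= /forallP fw ->] i|yw].
  by rewrite mxE; have := fw i; lia.
have lt (i : 'I_n) : (absz (y 0%R i - l 0%R i)%R < \max_i w i)%N.
  by apply: leq_trans (leq_bigmax i); have := yw i; lia.
apply/imfsetP; exists [ffun i => Ordinal (lt i)] => /=.
  by apply/forallP => i; rewrite ffunE /=; have := yw i; lia.
by apply/rowP => i; rewrite mxE ffunE /=; have := yw i; lia.
Qed.

Lemma card_bx n (l : zlat n) (w : 'I_n -> nat) : #|` bx l w| = (\prod_i w i)%N.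
Proof.
rewrite /bx card_imfset /=; last first.
  by move=> f g /rowP fg; apply/ffunP => i; apply/val_inj; have := fg i; rewrite !mxE /=; lia.
set m := (\max_i w i)%N.
have -> : (\prod_i w i)%N = (\prod_i #|[pred k : 'I_m | (k < w i)%N]|)%N.
  apply: eq_bigr => i _; have wm : (w i <= m)%N by exact: leq_bigmax.
  rewrite -sum1_card -(big_ord_widen m (fun=> 1%N) wm).
  by rewrite sum1_card card_ord.
have := card_family (fun i => [pred k : 'I_m | (k < w i)%N]).
rewrite foldrE big_map big_enum /= => <-; rewrite cardE.
by congr size; apply: eq_enum => f.
Qed.

Lemma zaddE n (x v : zlat n) (i : 'I_n) : (x + v : zlat n) 0 i = x 0 i + v 0 i.
Proof. by rewrite mxE. Qed.

Lemma zoppE n (x : zlat n) (i : 'I_n) : (- x : zlat n) 0 i = - x 0 i.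
Proof. by rewrite mxE. Qed.

Definition norm1 n (v : zlat n) : nat := (\sum_i absz (v 0%R i))%N.

(** A nonzero coordinate moves one step towards 0. The last clause keeps walks from z to z + v
    inside any box containing both ends. *)
Lemma norm1_step n (v : zlat n) m : norm1 v = m.+1 ->
  exists v' k, [/\ norm1 v' = m, v = nb k v' &
    forall i, (0 <= v' 0 i <= v 0 i) \/ (v 0 i <= v' 0 i <= 0)].
Proof.
move=> vm.
have [i vi] : exists i, v 0 i != 0.
  apply/existsP; rewrite -[X in is_true X]negbK; apply/negP => /existsPn v0.
  by move: vm; rewrite /norm1 big1 // => i _; move: (v0 i); rewrite negbK => /eqP ->.
pose k : dir n := (i, 0 < v 0 i).
exists (nb (opp_dir k) v), k; split.
- have e : (\sum_(j < n | j != i) absz (nb (opp_dir k) v 0%R j) =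
            \sum_(j < n | j != i) absz (v 0%R j))%N.
    by apply: eq_bigr => j /negPf ji; rewrite nbE /= ji addr0.
  move: vm; rewrite /norm1 (bigD1 i) //= [in X in _ -> X](bigD1 i) //= e nbE /= eqxx.
  by move: vi; set t := bigop _ _ _; rewrite /sg; case: ltP => /=; lia.
- by rewrite nbKV.
- move=> j; rewrite nbE /=; case: (eqVneq j i) => [->|_].
    by move: vi; rewrite /sg; case: ltP => /=; lia.
  by rewrite addr0; lia.
Qed.

(** The edge boundary of [T] relative to [B]. *)
Definition inner_edges n (B T : {fset zlat n}) : nat :=
  (\sum_(k : dir n) cnt T (fun z => (nb k z \in B) && (nb k z \notin T)))%N.

(** A monotone walk of [norm1 v] unit steps from z to z + v stays in the box and must leave [T] at
    some step; for a fixed step, translation is injective, so that step is charged at most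
    [inner_edges] times. *)
Lemma cnt_translate n (l : zlat n) w (T : {fset zlat n}) (v : zlat n) :
  {subset T <= bx l w} ->
  (cnt T (fun z => ((z + v)%R \in bx l w) && ((z + v)%R \notin T)) <=
   norm1 v * inner_edges (bx l w) T)%N.
Proof.
move=> TB; have [m vm] : exists m, norm1 v = m by exists (norm1 v).
elim: m v vm => [|m IHm] v vm; rewrite vm.
  rewrite mul0n leqn0 cnt_sum big_seq big1 // => z zT.
  suff -> : v = 0 by rewrite addr0 zT andbF.
  apply/rowP => i; rewrite mxE; apply/eqP.
  by move/eqP: vm; rewrite /norm1 sum_nat_eq0 => /forallP /(_ i); rewrite /= absz_eq0.
have [v' [k [v'm vE v'v]]] := norm1_step vm.
(* Either the point before the last step is already outside [T], or the last step leaves [T]. *)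
apply: leq_trans (cntU (Q := fun z => (z + v' \in bx l w) && (z + v' \notin T))
  (R := fun z => (z + v' \in T) && ((nb k (z + v') \in bx l w) && (nb k (z + v') \notin T))) _) _.
  move=> z zT /andP[zvB]; have E : z + v = nb k (z + v').
    by rewrite vE; apply/rowP => j; rewrite nbE !mxE addrA.
  move=> zvT; have -> : (z + v')%R \in bx l w.
    apply/in_bx => i; have /in_bx /(_ i) := TB _ zT; move/in_bx: zvB => /(_ i).
    by move: (v'v i); rewrite !zaddE; lia.
  by rewrite -E zvB zvT; case: (_ \in T).
rewrite mulSn [leqRHS]addnC leq_add //; first by rewrite -v'm IHm.
rewrite /inner_edges (bigD1 k) //= -[leqLHS]addn0 leq_add //.
apply: (@leq_cnt_inj _ _ _ _ _ _ (fun z => z + v')) => [z zT /andP[-> ->] // | x y _ _ _ _].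
exact: addIr.
Qed.

(** * Isoperimetry in boxes *)

Definition window n (s : nat) (z : zlat n) : {fset zlat n} :=
  bx (\row_i (z 0 i - s%:Z)) (fun=> (2 * s)%N).

Lemma in_window n s (z y : zlat n) :
  reflect (forall i, - s%:Z <= y 0 i - z 0 i < s%:Z) (y \in window s z).
Proof.
apply: (iffP (in_bx _ _ _)) => h i; have := h i; rewrite mxE; lia.
Qed.

Lemma card_window n s (z : zlat n) : #|` window s z| = ((2 * s) ^ n)%N.
Proof. by rewrite card_bx prod_nat_const card_ord. Qed.

(** Double counting of pairs (z, z + v) with z in [T] and z + v in the box outside [T]: each z
    contributes at least [m] pairs, and each of the (2s)^n vectors v of the window, of norm at most
    n s, is bounded by [cnt_translate]. *)
Lemma relative_isoperimetry n (l : zlat n) w (T : {fset zlat n}) s m :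
  {subset T <= bx l w} ->
  (forall z, z \in T -> (m <= cnt (bx l w) (fun y => (y \notin T) && (y \in window s z)))%N) ->
  (#|` T| * m <= (2 * s) ^ n * (n * s * inner_edges (bx l w) T))%N.
Proof.
move=> TB Tm.
have -> : (#|` T| * m = \sum_(z <- T) m)%N by rewrite big_const_seq count_predT iter_addn_0 mulnC.
apply: (@leq_trans (\sum_(z <- T) cnt (window s (0%R : zlat n))
   (fun v : zlat n => ((z + v)%R \in bx l w) && ((z + v)%R \notin T)))%N).
  rewrite big_seq [leqRHS]big_seq; apply: leq_sum => z zT.
  apply: leq_trans (Tm z zT) _.
  apply: (@leq_cnt_inj _ _ _ _ _ _ (fun y => y - z)) => [y yB /andP[yT yz]|x y _ _ _ _].
    rewrite [z + _]addrC subrK yB yT !andbT; apply/in_window => i.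
    by move/in_window: yz => /(_ i); rewrite zaddE zoppE mxE subr0.
  by move/addIr.
under eq_bigr do rewrite cnt_sum.
rewrite exchange_big /= -(card_window s (0 : zlat n)) mulnC -iter_addn_0 -count_predT -big_const_seq.
rewrite big_seq [leqRHS]big_seq; apply: leq_sum => v /in_window vs.
rewrite -cnt_sum; apply: leq_trans (cnt_translate v TB) _.
rewrite leq_mul2r; apply/orP; right.
rewrite /norm1; have -> : (n * s = \sum_(i < n) s)%N by rewrite sum_nat_const card_ord.
by apply: leq_sum => i _; have := vs i; rewrite mxE; lia.
Qed.

Definition cube n (l : zlat n) (N : nat) : {fset zlat n} := bx l (fun=> N).

Lemma in_cube n (l : zlat n) N (y : zlat n) :
  reflect (forall i, l 0 i <= y 0 i < l 0 i + N%:Z) (y \in cube l N).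
Proof. exact: in_bx. Qed.

Lemma card_cube n (l : zlat n) N : #|` cube l N| = (N ^ n)%N.
Proof. by rewrite card_bx prod_nat_const card_ord. Qed.

Lemma leq_cube_window n (l z : zlat n) N s : z \in cube l N -> (s <= N)%N ->
  (s ^ n <= cnt (cube l N) (fun y => y \in window s z))%N.
Proof.
move=> /in_cube zB sN.
(* The cube of side [s] at z, pushed back in the coordinates where it would leave the large cube. *)
pose c : zlat n := \row_i (if z 0 i + s%:Z <= l 0 i + N%:Z then z 0 i else l 0 i + N%:Z - s%:Z).
rewrite -(card_cube c s); apply/fsubset_leq_card/fsubsetP => y /in_cube yc.
rewrite in_cnt; apply/andP; split; [apply/in_cube | apply/in_window] => i;
  by have := yc i; have := zB i; rewrite mxE; case: ifP; lia.
Qed.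

(** Each window centred in [T] meets the cube in at least s^n points, of which at most half lie in
    [T]. *)
Lemma isoperimetry n (l : zlat n) N (T : {fset zlat n}) s :
  {subset T <= cube l N} -> (2 * #|` T| <= s ^ n)%N -> (0 < s <= N)%N ->
  (#|` T| <= 2 ^ n.+1 * n * s * inner_edges (cube l N) T)%N.
Proof.
move=> TB Ts /andP[s0 sN].
have := @relative_isoperimetry _ _ _ T s (s ^ n - #|` T|) TB.
rewrite -/(cube l N) => /(_ _)/wrap[z zT|].
  rewrite leq_subLR; apply: leq_trans (leq_cube_window (TB _ zT) sN) _.
  apply: leq_trans (cntU (Q := fun y => y \in T)
    (R := fun y => (y \notin T) && (y \in window s z)) _) _.
    by move=> y _ ->; case: (y \in T).
  rewrite leq_add2r; apply: (@leq_card_inj _ _ _ _ id) => [y|x y _ _ //].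
  by rewrite in_cnt => /andP[].
move=> h; have sn0 : (0 < s ^ n)%N by rewrite expn_gt0 s0.
rewrite -(leq_pmul2l sn0).
have h2 : (s ^ n <= 2 * (s ^ n - #|` T|))%N by lia.
have h3 : (s ^ n * #|` T| <= 2 * (#|` T| * (s ^ n - #|` T|)))%N by nia.
apply: leq_trans h3 _; apply: leq_trans (leq_mul (leqnn 2) h) _.
by rewrite expnMn expnS !mulnA; nia.
Qed.

(** * Minimality as a flip inequality *)

(* Exchanging [A] between [M] and its complement changes the status of exactly
   the edges leaving [A]. *)
Definition flip_minimal n (M : pred (zlat n)) : Prop :=
  forall A : {fset zlat n},
    (\sum_(k : dir n) cnt A (fun x => (nb k x \notin A) && (M x != M (nb k x))) <=
     \sum_(k : dir n) cnt A (fun x => (nb k x \notin A) && (M x == M (nb k x))))%N.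

Definition dpairs n (A : {fset zlat n}) (P : zlat n -> dir n -> bool) :
    {fset (zlat n * dir n)} :=
  [fset e in (A `*` [fset k | k in {: dir n}]) | P e.1 e.2]%fset.

Lemma in_dpairs n (A : {fset zlat n}) P e :
  (e \in dpairs A P) = (e.1 \in A) && P e.1 e.2.
Proof. by rewrite !inE /= andbT. Qed.

Lemma card_dpairs n (A : {fset zlat n}) P :
  #|` dpairs A P| = (\sum_(k : dir n) cnt A (P^~ k))%N.
Proof.
have -> : (\sum_(k : dir n) cnt A (P^~ k))%N =
    size (flatten [seq [seq (x, k) | x <- [fset x in A | P x k]%fset] | k <- index_enum _]).
  rewrite size_flatten /shape -map_comp sumnE big_map.
  by apply: eq_bigr => k _; rewrite /= size_map.
apply/perm_size/uniq_perm.
- exact: fset_uniq.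
- apply: allpairs_uniq_dep.
  + exact: index_enum_uniq.
  + by move=> k _; apply: fset_uniq.
  + by move=> [k x] [k' x'] _ _ /= [-> ->].
- move=> [x k]; rewrite in_dpairs /=; apply/idP/flattenP => [xA|[s /mapP[k' _ ->]]].
  exists [seq (x, k) | x <- [fset x in A | P x k]%fset].
    by apply/mapP; exists k => //; rewrite mem_index_enum.
  by apply/mapP; exists x => //; rewrite in_cnt.
by move/mapP => [x' + [-> ->]]; rewrite in_cnt.
Qed.

Definition dedge n (e : zlat n * dir n) : {fset zlat n} := [fset e.1; nb e.2 e.1]%fset.

(** An edge of [edges] has an endpoint in [A], used as its base. An edge inside [A] has two such
    bases, hence an image of pairs rather than the pairs themselves. *)
Lemma edge_bd_edges n (A : {fset zlat n}) (K : set (zlat n)) :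
  edge_bd K `&` edges [set` A] =
  [set` [fset dedge e | e in dpairs A (fun x k => `[< K x >] != `[< K (nb k x) >])]%fset].
Proof.
apply/seteqP; split => e.
  move=> [[a [b [Ka Kb ab ->]]] [x [y [/= xA _ xy exy]]]].
  have /adjP[k yk] := xy; apply/imfsetP; exists (x, k) => /=; last by rewrite exy yk.
  rewrite in_dpairs /= xA -yk /=.
  have : x \in [fset a; b]%fset by rewrite exy !inE eqxx.
  have : y \in [fset a; b]%fset by rewrite exy !inE eqxx orbT.
  have xny : x != y by rewrite yk eq_sym nb_neq.
  by rewrite !inE => /orP[]/eqP yE /orP[]/eqP xE; rewrite xE yE in xny *;
    rewrite ?eqxx ?(asboolT Ka) ?(asboolF Kb) in xny *.
move=> /imfsetP[[x k] /=]; rewrite in_dpairs /= => /andP[xA Kxy] ->.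
have xy : adj x (nb k x) by apply/adjP; exists k.
split.
  case: (asboolP (K x)) Kxy => Kx; case: asboolP => // Ky _.
    by exists x, (nb k x).
  by exists (nb k x), x; split; rewrite // 1?adj_sym // /dedge fsetUC.
exists x, (nb k x); split => //=.
case: (boolP (nb k x \in A)) => yA; [by left|right].
by split; [exact/negP | exists x; rewrite // adj_sym].
Qed.

Lemma dedge_inj n (A : {fset zlat n}) e e' :
  e.1 \in A -> e'.1 \in A -> nb e.2 e.1 \notin A -> dedge e = dedge e' -> e = e'.
Proof.
case: e e' => [x k] [x' k'] /= xA x'A yA ee.
have : nb k x \in dedge (x', k') by rewrite -ee !inE eqxx orbT.
have : x \in dedge (x', k') by rewrite -ee !inE eqxx.
rewrite !inE /= => + /orP[/eqP yx|/eqP yy]; first by rewrite yx x'A in yA.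
move=> /orP[/eqP xx|/eqP xy].
  by rewrite xx in yy *; rewrite (nb_inj_dir yy).
by have := nb_neq x k; rewrite yy xy eqxx.
Qed.

(** The competitor is [M] with its status exchanged on [A]. Edges inside [A] keep their status and
    cancel; edges leaving [A] change it. *)
Lemma minimal_flip n (M : set (zlat n)) : minimal M -> flip_minimal (fun x => `[< M x >]).
Proof.
move=> [_ _ Mmin] A.
pose K := [set y | clos [set` A] y /\ if y \in A then ~ M y else M y].
have Kin x : x \in A -> `[< K x >] = ~~ `[< M x >].
  move=> xA; rewrite -asbool_neg; apply: asbool_equiv_eq; rewrite /K /= xA.
  by split=> [[]|] //; split => //; left.
have Kout x k : x \in A -> nb k x \notin A -> `[< K (nb k x) >] = `[< M (nb k x) >].
  move=> xA yA; apply: asbool_equiv_eq; rewrite /K /= (negPf yA).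
  split=> [[]|] //; split => //; right; split; first exact/negP.
  by exists x => //; rewrite adj_sym; apply/adjP; exists k.
have := Mmin [set` A] K (finite_fset A) _ _.
rewrite !edge_bd_edges /set_card !set_fsetK => /(_ _ _)/wrap[||].
- by move=> y [].
- apply/seteqP; split => y [].
    by move=> [_ Ky] [/= yA ?]; split; [move: Ky; rewrite (negPf (introN idP yA)) | split].
  move=> My [/= yA [w wA yw]]; split; last by split => //; exists w.
  by split; [right; split => //; exists w | rewrite (negPf (introN idP yA))].
set DM := dpairs _ _; set DK := dpairs _ _ => le.
pose inA := fun (x : zlat n) (k : dir n) => (nb k x \in A) && (`[< M x >] != `[< M (nb k x) >]).
pose outM := fun (x : zlat n) (k : dir n) => (nb k x \notin A) && (`[< M x >] != `[< M (nb k x) >]).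
pose outK := fun (x : zlat n) (k : dir n) => (nb k x \notin A) && (`[< M x >] == `[< M (nb k x) >]).
(* An upper bound suffices for the competitor; for [M], below, the inner and outgoing edges must be
   disjoint and the outgoing ones counted exactly. *)
have leK : (#|` [fset dedge e | e in DK]%fset| <=
    #|` [fset dedge e | e in dpairs A inA]%fset| + \sum_k cnt A (outK^~ k))%N.
  rewrite -(card_dpairs A outK).
  have le2 : (#|` [fset dedge e | e in dpairs A outK]%fset| <= #|` dpairs A outK|)%N.
    exact: leq_imfset_card.
  apply: leq_trans (leq_add (leqnn _) le2).
  apply: leq_trans (leq_card_fsetU _ _).
  apply/fsubset_leq_card/fsubsetP => e /imfsetP[[x k] /=].
  rewrite in_dpairs /= => /andP[xA Kxy] ->; rewrite in_fsetU; apply/orP.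
  case: (boolP (nb k x \in A)) => yA; [left|right]; apply/imfsetP;
    exists (x, k) => //=; rewrite in_dpairs /= xA /inA /outK ?yA /=.
    by move: Kxy; rewrite !Kin // (inj_eq negb_inj).
  by move: Kxy; rewrite Kin // (Kout _ _ xA yA); do 2! case: `[< _ >].
have leM : (#|` [fset dedge e | e in dpairs A inA]%fset| + \sum_k cnt A (outM^~ k) <=
    #|` [fset dedge e | e in DM]%fset|)%N.
  rewrite -(card_dpairs A outM).
  have <- : #|` [fset dedge e | e in dpairs A outM]%fset| = #|` dpairs A outM|.
    apply: card_in_imfset => e e'; rewrite !in_dpairs => /andP[? /andP[? _]] /andP[? _].
    exact: (@dedge_inj _ A).
  set X := imfset _ _ _; set Y := imfset _ _ _.
  have <- : #|` (X `|` Y)%fset| = (#|` X| + #|` Y|)%N.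
    rewrite -cardfsUI; suff -> : (X `&` Y = fset0)%fset by rewrite cardfs0 addn0.
    apply/fsetP => z; rewrite in_fsetI in_fset0; apply/negP => /andP[].
    move=> /imfsetP[[x k] /=]; rewrite in_dpairs /= => /andP[xA /andP[yA _]] ->.
    move=> /imfsetP[[x' k'] /=]; rewrite in_dpairs /= => /andP[xA' /andP[yA' _]] ee.
    have : nb k' x' \in dedge (x, k) by rewrite ee !inE eqxx orbT.
    by rewrite !inE /= => /orP[]/eqP e; move: yA'; rewrite e ?xA ?yA.
  apply/fsubset_leq_card/fsubsetP => z; rewrite in_fsetU => /orP[] /imfsetP[[x k] /=];
    rewrite in_dpairs /= => /andP[xA /andP[_ Mxy]] ->;
    by apply/imfsetP; exists (x, k) => //=; rewrite in_dpairs /= xA.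
by have := leq_trans leM (leq_trans le leK); rewrite leq_add2l.
Qed.

(** The flip inequality only sees where [M] changes, so estimates obtained by removing vertices also
    hold for filling them in. *)
Lemma flip_minimalC n (M : pred (zlat n)) : flip_minimal M -> flip_minimal (fun x => ~~ M x).
Proof.
move=> Mf A; have := Mf A; congr leq; apply: eq_bigr => k _; apply: eq_cnt => x _.
  by rewrite (inj_eq negb_inj).
by rewrite (inj_eq negb_inj).
Qed.

Lemma flip_remove n (M : pred (zlat n)) (A : {fset zlat n}) :
  flip_minimal M -> (forall x, x \in A -> M x) ->
  (\sum_(k : dir n) cnt A (fun x => ~~ M (nb k x)) <=
   \sum_(k : dir n) cnt A (fun x => M (nb k x) && (nb k x \notin A)))%N.
Proof.
move=> Mf AM; have := Mf A; congr leq; apply: eq_bigr => k _; apply: eq_cnt => x /AM ->.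
  case: (boolP (nb k x \in A)) => [/AM ->|_] //.
by rewrite andbC; case: (M _).
Qed.

(** * Volume growth *)

Lemma leq_expnl n a b : (a <= b)%N -> (a ^ n <= b ^ n)%N.
Proof. by case: n => [|n] // ab; rewrite leq_exp2r. Qed.

Definition cball n (x : zlat n) (r : nat) : {fset zlat n} :=
  cube (\row_i (x 0 i - r%:Z)) (2 * r).+1.

Lemma in_ball n (x y : zlat n) r :
  reflect (forall i, - r%:Z <= y 0 i - x 0 i <= r%:Z) (y \in cball x r).
Proof. by apply: (iffP (in_cube _ _ _)) => h i; have := h i; rewrite mxE; lia. Qed.

Lemma ball_center n (x : zlat n) r : x \in cball x r.
Proof. by apply/in_ball => i; lia. Qed.

Lemma subset_ball n (x : zlat n) r r' : (r <= r')%N -> {subset cball x r <= cball x r'}.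
Proof. by move=> rr y /in_ball yr; apply/in_ball => i; have := yr i; lia. Qed.

Lemma nb_ball n (x y : zlat n) k r : y \in cball x r -> nb k y \in cball x r.+1.
Proof.
move=> /in_ball yr; apply/in_ball => i; have := yr i; rewrite nbE.
by case: (i == k.1); case: k.2; rewrite /sg /=; lia.
Qed.

Definition vol n (M : pred (zlat n)) (x : zlat n) (r : nat) : nat := cnt (cball x r) M.

Lemma vol_gt0 n (M : pred (zlat n)) (x : zlat n) r : M x -> (0 < vol M x r)%N.
Proof. by move=> Mx; rewrite cardfs_gt0; apply/fset0Pn; exists x; rewrite in_cnt ball_center Mx. Qed.

Lemma vol_mono n (M : pred (zlat n)) (x : zlat n) r r' :
  (r <= r')%N -> (vol M x r <= vol M x r')%N.
Proof.
move=> rr; apply: (@leq_cnt_inj _ _ _ _ _ _ id) => // y yr ->.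
by rewrite (subset_ball rr).
Qed.

Lemma ball_exit_inj n (x y y' : zlat n) r (k k' : dir n) :
  y \in cball x r -> y' \in cball x r -> nb k y \notin cball x r ->
  nb k y = nb k' y' -> y = y' /\ k = k'.
Proof.
move=> yr y'r exy e; suff kk : k = k' by split=> //; apply: (@nb_inj _ k); rewrite {2}kk.
move: exy; have -> : (nb k y \in cball x r) = [forall i, - r%:Z <= nb k y 0 i - x 0 i <= r%:Z].
  by apply/in_ball/forallP.
move=> /forallPn[i]; move/in_ball: yr => /(_ i); move/in_ball: y'r => /(_ i).
have := congr1 (fun z : zlat n => z 0 i) e; rewrite /= !nbE.
case: eqP => [ik|_]; case: eqP => [ik'|_]; try lia.
case: k k' ik ik' {e} => [j b] [j' b'] /= -> ->.
by case: b b' => [] [] //; rewrite /sg; lia.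
Qed.

(** By [ball_exit_inj], edges from [M] in the ball to [M] outside end at distinct points of the next
    shell. *)
Lemma exit_count n (M : pred (zlat n)) (x : zlat n) r :
  let A := [fset y in cball x r | M y]%fset in
  (\sum_(k : dir n) cnt A (fun y => M (nb k y) && (nb k y \notin A)) + vol M x r <=
   vol M x r.+1)%N.
Proof.
rewrite /=; set A := imfset _ _ _.
have inA y : (y \in A) = (y \in cball x r) && M y by rewrite in_cnt.
have -> : vol M x r.+1 =
    (cnt (cball x r.+1) (fun y => M y && (y \notin cball x r)) + vol M x r)%N.
  rewrite /vol (cntID _ M (fun y => y \notin cball x r)); congr (_ + _)%N.
  apply/eqP; rewrite eqn_leq; apply/andP; split; apply: (@leq_cnt_inj _ _ _ _ _ _ id) => // y.
    by move=> _ /andP[-> /negPn ->].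
  by move=> yr My; rewrite (subset_ball _ yr) // My yr.
rewrite leq_add2r -(card_dpairs A (fun y k => M (nb k y) && (nb k y \notin A))).
apply: (@leq_card_inj _ _ _ _ (fun e => nb e.2 e.1)) => [[y k]|[y k] [y' k']].
  rewrite in_dpairs in_cnt !inA /= => /andP[/andP[yr My] /andP[My' yA]].
  by rewrite nb_ball //= My' /=; move: yA; rewrite My' andbT.
rewrite !in_dpairs !inA /= => /andP[/andP[yr My] /andP[Mky yA]] /andP[/andP[y'r _] _] e.
have [|-> -> //] := ball_exit_inj yr y'r _ e.
by move: yA; rewrite Mky andbT.
Qed.

Lemma flip_exit n (M : pred (zlat n)) (x : zlat n) r : flip_minimal M ->
  (\sum_(k : dir n) cnt (cball x r) (fun y => M y && ~~ M (nb k y)) + vol M x r <=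
   vol M x r.+1)%N.
Proof.
move=> Mf; apply: leq_trans (exit_count M x r); rewrite leq_add2r.
apply: leq_trans (flip_remove Mf _) => [|y]; last by rewrite in_cnt => /andP[].
apply: leq_sum => k _; apply: (@leq_cnt_inj _ _ _ _ _ _ id) => // y yB /andP[My ->].
by rewrite in_cnt yB My.
Qed.

(** Let V and V' be the volumes at [r] and [r.+1]. Minimality bounds the edges from [M] in the ball
    out of [M] by the edges to the rest of [M], hence by V' - V. So 2 (V' - V) bounds the whole edge
    boundary, and isoperimetry at scale [s] gives the growth. *)
Lemma vol_step n (M : pred (zlat n)) (x : zlat n) r s :
  flip_minimal M -> (0 < s)%N -> (2 * vol M x r <= s ^ n)%N ->
  (vol M x r + 2 ^ n.+2 * n * s * vol M x r <= 2 ^ n.+2 * n * s * vol M x r.+1)%N.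
Proof.
move=> Mf s0 Vs; pose A := [fset y in cball x r | M y]%fset.
(* Radius [r + s] makes the side of the ambient cube at least [s]. *)
have AB : {subset A <= cball x (r + s)}.
  by move=> y; rewrite in_cnt => /andP[yr _]; apply: subset_ball yr; rewrite leq_addr.
have := isoperimetry AB Vs; rewrite -/(vol M x r) => /(_ _)/wrap[|iso]; first by rewrite s0 /=; lia.
have E : (inner_edges (cball x (r + s)) A + 2 * vol M x r <= 2 * vol M x r.+1)%N.
  have /= := exit_count M x r; rewrite -/A.
  have := @flip_remove n M A Mf; move=> /(_ _)/wrap[y|fl ex]; first by rewrite in_cnt => /andP[].
  move: ex fl; set a := (\sum_k _)%N; set b := (\sum_k _)%N => ex fl.
  suff : (inner_edges (cball x (r + s)) A <= a + b)%N by lia.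
  rewrite /inner_edges /a /b -big_split /=; apply: leq_sum => k _; apply: cntU => y _ /andP[_ ->].
  by case: (M _).
move: iso E; set V := vol M x r; set V' := vol M x r.+1; set e := inner_edges _ _.
rewrite [(2 ^ n.+2)%N]expnS; set c := (2 ^ n.+1)%N => iso E.
have qE : (2 * c * n * s = 2 * (c * n * s))%N by rewrite !mulnA.
rewrite qE; move: (c * n * s)%N iso => q iso.
have : (q * (e + 2 * V) <= q * (2 * V'))%N by rewrite leq_mul2l E orbT.
have {}iso : (V <= q * e)%N by exact: iso.
by rewrite mulnDr; nia.
Qed.

Definition growth_scale n : nat := (2 ^ (n + n + 4) * n)%N.

(** If the bound failed at 2m = 2^(k+1), [vol_step] at scale 2m would apply to all radii from C m to
    2 C m. Each step adds at least m^n / (2 D), and [growth_scale] is chosen so that C m such steps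
    add up to (2m)^n, a contradiction. *)
Lemma vol_dyadic n (M : pred (zlat n)) (x : zlat n) k :
  flip_minimal M -> M x ->
  ((2 ^ k) ^ n <= 2 * vol M x (growth_scale n * 2 ^ k))%N.
Proof.
move=> Mf Mx; elim: k => [|k IHk].
  by rewrite exp1n muln1; have := vol_gt0 (growth_scale n) Mx; lia.
rewrite leqNgt; apply/negP => lt.
set m := (2 ^ k)%N in IHk; set C := growth_scale n in IHk lt.
have m0 : (0 < m)%N by rewrite expn_gt0.
have mE : (2 ^ k.+1 = 2 * m)%N by rewrite expnS.
rewrite mE in lt.
pose D := (2 ^ n.+2 * n * (2 * m))%N.
have step j : (j <= C * m)%N -> (j * m ^ n <= 2 * (D * vol M x (C * m + j)))%N.
  elim: j => [|j IHj] jC; first by rewrite mul0n.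
  have {}IHj := IHj (ltnW jC).
  have Vj : (vol M x (C * m) <= vol M x (C * m + j))%N by rewrite vol_mono ?leq_addr.
  have := @vol_step n M x (C * m + j) (2 * m) Mf _ _.
  rewrite -/D -addnS => /(_ _ _)/wrap[|| st]; first by rewrite muln_gt0.
    apply: ltnW; apply: leq_ltn_trans lt; rewrite leq_mul2l /=.
    by apply: vol_mono; rewrite mulnCA mul2n -addnn leq_add2l ltnW.
  by rewrite mulSn; lia.
have := step (C * m)%N (leqnn _).
have -> : (C * m + C * m = C * (2 * m))%N by rewrite mulnCA mul2n addnn.
have V0 := vol_gt0 (C * (2 * m)) Mx; move: lt V0; set V := vol _ _ _ => lt V0 h.
have n0 : (0 < n)%N.
  case: (posnP n) => // e; move: lt; have -> : ((2 * m) ^ n = 1)%N by rewrite e.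
  by lia.
have a0 : (0 < 2 ^ n)%N by rewrite expn_gt0.
have DE : D = (8 * (2 ^ n * n * m))%N by rewrite /D !expnS; lia.
have CE : C = (16 * (2 ^ n * 2 ^ n * n))%N by rewrite /C /growth_scale addn4 !expnS expnD; lia.
rewrite expnMn in lt; rewrite DE CE in h.
have q0 : (0 < 2 ^ n * n * m)%N by rewrite !muln_gt0 a0 n0 m0.
have : (2 ^ n * n * m * (2 ^ n * m ^ n) <= 2 ^ n * n * m * V)%N.
  by move: (2 ^ n)%N (m ^ n)%N h => a b; lia.
by rewrite leq_pmul2l //; lia.
Qed.

(** For radii up to C the point x alone is enough volume; a larger radius lies between C 2^k and 2 C
    2^k for some k. *)
Lemma volume_growth n : exists2 G, (0 < G)%N & forall (M : pred (zlat n)) x r,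
  flip_minimal M -> M x -> ((2 * r).+1 ^ n <= G * vol M x r)%N.
Proof.
pose C := growth_scale n; exists (3 ^ n * (2 * (2 * C).+1 ^ n))%N => [|M x r Mf Mx].
  by rewrite !muln_gt0 !expn_gt0.
have V0 := vol_gt0 r Mx.
have [->|r0] := posnP r.
  by rewrite muln0 exp1n muln_gt0 vol_gt0 // andbT !muln_gt0 !expn_gt0.
apply: (@leq_trans (3 ^ n * r ^ n)%N); first by rewrite -expnMn leq_expnl //; lia.
rewrite -mulnA leq_mul2l; apply/orP; right.
have [rC|Cr] := leqP r C.
  apply: (@leq_trans ((2 * C).+1 ^ n)%N); first by rewrite leq_expnl //; lia.
  by rewrite mulnAC leq_pmull // muln_gt0.
have [n0|n0] := posnP n.
  have -> : (r ^ n = 1)%N by rewrite n0.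
  by rewrite !muln_gt0 expn_gt0 /=.
have C0 : (0 < C)%N by rewrite /C /growth_scale muln_gt0 expn_gt0.
have q0 : (0 < r %/ C)%N by rewrite divn_gt0 // ltnW.
have /andP[k1 k2] := trunc_log_bounds (ltnSn 1) q0.
set k := trunc_log 2 (r %/ C) in k1 k2.
have Ck : (C * 2 ^ k <= r)%N by rewrite mulnC -leq_divRL.
have rCk : (r <= 2 * C * 2 ^ k)%N.
  by rewrite -mulnA mulnCA -expnS mulnC ltnW // -ltn_divLR.
apply: (leq_trans (leq_expnl n rCk)); rewrite expnMn -[leqRHS]mulnA [leqRHS]mulnCA leq_mul //.
  by rewrite leq_expnl.
by apply: leq_trans (vol_dyadic k Mf Mx) _; rewrite leq_mul2l vol_mono.
Qed.

(** * Thin points *)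

Definition corner n (t : 'I_n -> bool) (I : {set 'I_n}) (x : zlat n) : zlat n :=
  \row_i (x 0 i + (if i \in I then sg (t i) else 0)).

Lemma cornerE n t (I : {set 'I_n}) (x : zlat n) (i : 'I_n) :
  corner t I x 0 i = x 0 i + (if i \in I then sg (t i) else 0).
Proof. by rewrite mxE. Qed.

Lemma corner0 n (t : 'I_n -> bool) (x : zlat n) : corner t finset.set0 x = x.
Proof. by apply/rowP => i; rewrite cornerE inE addr0. Qed.

Lemma nb_corner n (t : 'I_n -> bool) (I : {set 'I_n}) (x : zlat n) i :
  i \notin I -> nb (i, t i) (corner t I x) = corner t (i |: I) x.
Proof.
move=> iI; apply/rowP => j; rewrite nbE !cornerE in_setU1 /=.
by case: (eqVneq j i) => [->|_]; rewrite ?(negPf iI) ?addr0.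
Qed.

(** Undoing the moves of [I] one at a time must at some point enter [P], which gives a cube edge
    leaving [P]. *)
Lemma corner_path n (P : pred (zlat n)) (t : 'I_n -> bool) (I : {set 'I_n}) (x : zlat n) :
  P x -> ~~ P (corner t I x) ->
  exists (J : {set 'I_n}) i, [/\ J \subset I, i \in I, i \notin J, P (corner t J x) &
    ~~ P (nb (i, t i) (corner t J x))].
Proof.
move=> Px; have [m] := ubnP #|I|; elim: m I => // m IHm I Im PI.
have [I0|[i iI]] := set_0Vmem I; first by rewrite I0 corner0 Px in PI.
have iIi : i \notin I :\ i by rewrite !inE eqxx.
have [PJ|PJ] := boolP (P (corner t (I :\ i) x)).
  by exists (I :\ i), i; split; rewrite // ?finset.subsetDl // nb_corner // finset.setD1K.
have lt : (#|I :\ i| < m)%N by move: Im; rewrite (finset.cardsD1 i) iI add1n ltnS.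
have [J [j [JI jI jJ ? ?]]] := IHm _ lt PJ.
exists J, j; split=> //; first exact: fintype.subset_trans JI (finset.subsetDl _ _).
by move: jI; rewrite !inE => /andP[].
Qed.

Definition cpart n (M : pred (zlat n)) : pred (zlat n) :=
  fun x => `[< cube_part [set y | M y] x >].

Definition thin n (M : pred (zlat n)) : pred (zlat n) := fun x => M x && ~~ cpart M x.

Lemma cpart_sub n (M : pred (zlat n)) x : cpart M x -> M x.
Proof. by move=> /asboolP[]. Qed.

(** Each choice of signs gives a unit cube containing x, and none lies in [M]. The free choice of
    [t] serves later to keep the cube inside a ball or a slab. *)
Lemma thin_corner n (M : pred (zlat n)) (t : 'I_n -> bool) x : thin M x ->
  exists I : {set 'I_n}, ~~ M (corner t I x).
Proof.
move=> /andP[Mx /asboolPn nx]; apply/not_existsP => cM; apply: nx; split => //.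
pose z : zlat n := \row_i (if t i then x 0 i else x 0 i - 1).
exists z.
  by move=> i; rewrite mxE; case: (t i); [left|right]; lia.
move=> y zy /=; suff -> : y = corner t [set i | y 0%R i != x 0%R i]%SET x.
  by move: (cM [set i | y 0%R i != x 0%R i]%SET) => /negP; rewrite negbK.
apply/rowP => i; rewrite cornerE inE; move: (zy i); rewrite mxE /sg.
by case: (t i); case: eqP => /=; lia.
Qed.

Lemma cpart_nb n (M : pred (zlat n)) x i : cpart M x -> exists b, cpart M (nb (i, b) x).
Proof.
move=> /asboolP[Mx [z zx zM]]; exists (x 0 i == z 0 i).
suff zb : unit_cube z (nb (i, x 0 i == z 0 i) x).
  by apply/asboolP; split; [exact: zM | exists z].
move=> j; rewrite nbE /=; have := zx j; have := zx i.
by case: (eqVneq j i) => [->|_]; rewrite ?addr0 // /sg; case: eqP; lia.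
Qed.

Lemma corner_ball n t (I : {set 'I_n}) (x y : zlat n) r :
  y \in cball x r -> corner t I y \in cball x r.+1.
Proof.
move=> /in_ball yr; apply/in_ball => i; have := yr i; rewrite cornerE /sg.
by case: (i \in I); case: (t i); lia.
Qed.

(** A cube with a missing corner has an edge leaving [M], and one of 2^n offsets recovers the thin
    point from the base of that edge. *)
Lemma thin_count n (M : pred (zlat n)) (x : zlat n) r :
  (cnt (cball x r) (thin M) <=
   2 ^ n * \sum_(k : dir n) cnt (cball x r.+1) (fun y => M y && ~~ M (nb k y)))%N.
Proof.
pose t (_ : 'I_n) := true.
apply: leq_trans (leq_cnt_cover (K := ({set 'I_n} * dir n)%type) (B := fun=> cball x r.+1)
  (Q := fun Jk y => M y && ~~ M (nb Jk.2 y))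
  (f := fun Jk y => \row_i (y 0 i - (if i \in Jk.1 then 1 else 0))) _) _.
  move=> y yr Sy; have [I yI] := thin_corner t Sy; have /andP[My _] := Sy.
  have [J [i [_ _ _ MJ MiJ]]] := corner_path My yI.
  exists (J, (i, true)), (corner t J y); rewrite corner_ball // MJ MiJ; split=> //.
  by apply/rowP => j; rewrite mxE cornerE addrK.
rewrite -(pair_bigA _ (fun J k => cnt (cball x r.+1) (fun y => M y && ~~ M (nb k y)))) /=.
rewrite sum_nat_const leq_mul2r; apply/orP; right.
by rewrite -cardsT -powersetT card_powerset cardsT card_ord.
Qed.

(** Induction with N + 2 <= 3 N. The extra term on the left encodes the factor 3^n - 1, with which
    the induction closes. *)
Lemma exp_shell N n : (0 < N)%N -> (0 < n)%N ->
  (N.+2 ^ n + N ^ n.-1 <= N ^ n + 3 ^ n * N ^ n.-1)%N.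
Proof.
move=> N0; case: n => // n _; elim: n => [|n IHn]; first by rewrite !expn1 !expn0; lia.
move: IHn; rewrite /= 3![(_ ^ n.+2)%N]expnS.
have : (0 < 3 ^ n.+1)%N by rewrite expn_gt0.
rewrite !(expnS N); move: (N.+2 ^ n.+1)%N (N ^ n)%N (3 ^ n.+1)%N => a b c c0 h.
have h1 : (N.+2 * (a + b) <= N.+2 * (N * b + c * b))%N by rewrite leq_mul2l h orbT.
have h2 : (c.-1 * b * N.+2 <= c.-1 * b * (3 * N))%N by rewrite leq_mul2l; apply/orP; right; lia.
by case: c c0 h h1 h2 => // c _ _; nia.
Qed.

(** By [flip_exit] the boundary edges are at most the points of [M] in a shell of thickness one,
    hence at most all points of that shell. *)
Lemma perimeter_bound n (M : pred (zlat n)) (x : zlat n) r : flip_minimal M -> (0 < n)%N ->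
  (\sum_(k : dir n) cnt (cball x r) (fun y => M y && ~~ M (nb k y)) <=
   3 ^ n * (2 * r).+1 ^ n.-1)%N.
Proof.
move=> Mf n0; have h1 := flip_exit x r Mf.
have h2 : (vol (predC M) x r <= vol (predC M) x r.+1)%N by rewrite vol_mono.
have V s : (vol M x s + vol (predC M) x s = (2 * s).+1 ^ n)%N.
  rewrite -(card_cube (\row_i (x 0 i - s%:Z) : zlat n)) -/(cball x s).
  have -> : #|` cball x s| = cnt (cball x s) predT.
    by apply/eqP; rewrite eqn_leq leq_cnt_card andbT; apply/fsubset_leq_card/fsubsetP => y yx;
      rewrite in_cnt yx.
  by rewrite (cntID _ predT M).
have := @exp_shell (2 * r).+1 n isT n0.
have := V r; have := V r.+1; rewrite mulnS add2n.
by move: h1 h2; set a := (\sum_k _)%N; lia.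
Qed.

(** Thin points are of order at most r^(n-1), by [thin_count] and [perimeter_bound], against a
    volume of order r^n. *)
Lemma thin_sparse n : (0 < n)%N -> exists r0, forall (M : pred (zlat n)) x r,
  flip_minimal M -> M x -> (r0 <= r)%N ->
  (vol M x r <= 2 * cnt (cball x r) (cpart M))%N.
Proof.
move=> n0; have [G G0 grow] := volume_growth n.
exists (G * 2 ^ n * 3 ^ n * 3 ^ n)%N => M x r Mf Mx rr.
suff : (2 * cnt (cball x r) (thin M) <= vol M x r)%N.
  have -> : vol M x r = (cnt (cball x r) (cpart M) + cnt (cball x r) (thin M))%N; last by lia.
  rewrite /vol (cntID _ M (cpart M)); congr (_ + _)%N; apply: eq_cnt => y _.
  by rewrite andbC; case: (boolP (cpart M y)) => // /cpart_sub ->.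
rewrite -(leq_pmul2l G0); apply: leq_trans (grow M x r Mf Mx).
have h := leq_trans (thin_count M x r) (leq_mul (leqnn _) (perimeter_bound x r.+1 Mf n0)).
have h3 : ((2 * r.+1).+1 ^ n.-1 <= 3 ^ n * (2 * r).+1 ^ n.-1)%N.
  apply: (@leq_trans (3 ^ n.-1 * (2 * r).+1 ^ n.-1)%N); last by rewrite leq_mul2r leq_exp2l // leq_pred orbT.
  by rewrite -expnMn leq_expnl //; lia.
have -> : ((2 * r).+1 ^ n = (2 * r).+1 * (2 * r).+1 ^ n.-1)%N by rewrite -expnS prednK.
move: h h3; set p := ((2 * r.+1).+1 ^ n.-1)%N; set q := ((2 * r).+1 ^ n.-1)%N => h h3.
have h4 : (G * cnt (cball x r) (thin M) <= G * 2 ^ n * 3 ^ n * 3 ^ n * q)%N.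
  rewrite -!mulnA leq_mul2l; apply/orP; right; apply: (leq_trans h).
  by rewrite leq_mul2l; apply/orP; right; rewrite leq_mul2l h3 orbT.
have : (G * 2 ^ n * 3 ^ n * 3 ^ n * q <= r * q)%N by rewrite leq_mul2r rr orbT.
by rewrite mulnCA mulSn -mulnA; move: h4; lia.
Qed.

(** * Thin points near a hyperplane *)

(** Steps inside [A] in direction k and in the opposite direction undo each other, so they are
    equally many, and so are the exits. *)
Lemma exit_balance n (A : {fset zlat n}) (k : dir n) :
  cnt A (fun y => nb k y \notin A) = cnt A (fun y => nb (opp_dir k) y \notin A).
Proof.
have E k' : (cnt A (fun y => nb k' y \in A) <= cnt A (fun y => nb (opp_dir k') y \in A))%N.
  apply: (@leq_cnt_inj _ _ _ _ _ _ (nb k')) => [y yA ->|y z _ _ _ _]; last exact: nb_inj.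
  by rewrite nbK yA.
have F k' : (cnt A (fun y => nb k' y \in A) + cnt A (fun y => nb k' y \notin A) = cnt A predT)%N.
  by rewrite (cntID _ predT (fun y => nb k' y \in A)).
have := F k; have := F (opp_dir k); have := E k; have := E (opp_dir k); rewrite opp_dirK.
lia.
Qed.

(** * Slabs, levels and projection along one coordinate *)

Definition setc n (i : 'I_n) (v : int) (y : zlat n) : zlat n :=
  \row_j (if j == i then v else y 0 j).

Lemma setcE n (i : 'I_n) v (y : zlat n) (j : 'I_n) : setc i v y 0 j = if j == i then v else y 0 j.
Proof. by rewrite mxE. Qed.

Lemma setc_setc n (i : 'I_n) v w (y : zlat n) : setc i v (setc i w y) = setc i v y.
Proof. by apply/rowP => j; rewrite !setcE; case: (j == i). Qed.

Lemma setc_id n (i : 'I_n) (y : zlat n) : setc i (y 0 i) y = y.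
Proof. by apply/rowP => j; rewrite !setcE; case: eqP => [->|]. Qed.

Lemma nb_setc n (i : 'I_n) v (y : zlat n) k : k.1 != i -> nb k (setc i v y) = setc i v (nb k y).
Proof.
move=> ki; apply/rowP => j; rewrite nbE !setcE nbE; case: (eqVneq j i) => [->|//].
by rewrite eq_sym (negPf ki) addr0.
Qed.

Definition slab n (i : 'I_n) (c : zlat n) (r t : nat) : {fset zlat n} :=
  bx (\row_j (c 0 j - (if j == i then t else r)%:Z)) (fun j => (2 * (if j == i then t else r)).+1).

Lemma in_slab n (i : 'I_n) (c y : zlat n) r t :
  reflect (forall j, - (if j == i then t else r)%:Z <= y 0 j - c 0 j <= (if j == i then t else r)%:Z)
    (y \in slab i c r t).
Proof.
by apply: (iffP (in_bx _ _ _)) => h j; have := h j; rewrite mxE; case: (j == i); lia.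
Qed.

Lemma card_slab n (i : 'I_n) (c : zlat n) r t :
  #|` slab i c r t| = ((2 * t).+1 * (2 * r).+1 ^ n.-1)%N.
Proof.
rewrite card_bx (bigD1 i) //= eqxx; congr (_ * _)%N.
rewrite (eq_bigr (fun=> (2 * r).+1)) => [|j /negPf -> //].
rewrite prod_nat_const; congr (_ ^ _)%N.
have := cardC1 i; rewrite card_ord => <-.
by apply: eq_card => j; rewrite !inE.
Qed.

Definition level n (i : 'I_n) (c : zlat n) (r : nat) (t : int) : {fset zlat n} :=
  slab i (setc i (c 0 i + t) c) r 0.

Lemma in_level n (i : 'I_n) (c y : zlat n) r t :
  reflect (y 0 i = c 0 i + t /\ forall j, j != i -> - r%:Z <= y 0 j - c 0 j <= r%:Z)
    (y \in level i c r t).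
Proof.
apply: (iffP (in_slab _ _ _ _ _)) => [h|[e h] j].
  split=> [|j ji]; last by have := h j; rewrite setcE (negPf ji).
  by have := h i; rewrite setcE eqxx; lia.
rewrite setcE; case: (eqVneq j i) => [->|/h]; lia.
Qed.

Lemma setc_level n (i : 'I_n) (c y : zlat n) r t T :
  y \in slab i c r t -> setc i (c 0 i + T) y \in level i c r T.
Proof.
move=> /in_slab h; apply/in_level; rewrite setcE eqxx; split=> // j ji.
by have := h j; rewrite setcE (negPf ji).
Qed.

Lemma nb_slab n (i : 'I_n) (c y : zlat n) r t k : k.1 != i -> y \in slab i c r t ->
  (nb k y \in slab i c r t) = (- r%:Z <= nb k y 0 k.1 - c 0 k.1 <= r%:Z).
Proof.
move=> ki /in_slab yr; apply/in_slab/idP => [/(_ k.1)|h j]; first by rewrite (negPf ki).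
case: (eqVneq j k.1) => [->|jk]; first by rewrite (negPf ki).
by rewrite nbE (negPf jk) addr0; apply: yr.
Qed.

Lemma sum_dir n (i : 'I_n) (F : dir n -> nat) :
  (\sum_(k : dir n) F k = F (i, true) + F (i, false) + \sum_(k : dir n | k.1 != i) F k)%N.
Proof.
rewrite (bigD1 (i, true)) //= (bigD1 (i, false)) /=; last by apply/eqP => -[].
rewrite addnA; congr (_ + _)%N.
by apply: eq_bigl => -[j b]; rewrite !xpair_eqE /= -negb_or -andb_orr; case: b; rewrite andbT.
Qed.

(* Flipping this set makes the slab cylindrical over its upper level. *)
Definition slab_diff n (M : pred (zlat n)) i c r T : {fset zlat n} :=
  [fset y in slab i c r T.-1 | M y != M (setc i (c 0%R i + T%:Z)%R y)]%fset.

Lemma in_slab_diff n (M : pred (zlat n)) i (c y : zlat n) r T :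
  (y \in slab_diff M i c r T) =
  (y \in slab i c r T.-1) && (M y != M (setc i (c 0 i + T%:Z) y)).
Proof. by rewrite in_cnt. Qed.

(** If the point above y is in the slab, it agrees with the upper level while y does not. Otherwise
    it is the upper level point itself, since the slab has half thickness [T.-1]. *)
Lemma slab_diff_up n (M : pred (zlat n)) i (c y : zlat n) r T :
  (0 < T)%N -> y \in slab_diff M i c r T -> nb (i, true) y \notin slab_diff M i c r T ->
  M y != M (nb (i, true) y).
Proof.
move=> T0; rewrite !in_slab_diff => /andP[ys My].
have nt : setc i (c 0 i + T%:Z) (nb (i, true) y) = setc i (c 0 i + T%:Z) y.
  by apply/rowP => j; rewrite !setcE nbE /=; case: (j == i); rewrite ?addr0.
rewrite nt; have [ns|ns] := boolP (_ \in slab _ _ _ _).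
  by rewrite /= negbK => /eqP ->.
move=> _; suff -> : nb (i, true) y = setc i (c 0 i + T%:Z) y by [].
apply/rowP => j; rewrite setcE nbE /=; case: (eqVneq j i) => [->|_]; last by rewrite addr0.
apply/eqP; apply: contraNT ns => ne; apply/in_slab => j'.
move/in_slab: ys => /(_ j'); rewrite nbE /=; case: (eqVneq j' i) => [->|_]; last by rewrite addr0.
by move: ne; rewrite /sg; lia.
Qed.

(** All upward exits are boundary edges of [M], as many as the downward exits by [exit_balance].
    This gain cancels the downward exits that are not boundary edges and doubles those that are. *)
Lemma slab_flip n (M : pred (zlat n)) i (c : zlat n) r T :
  flip_minimal M -> (0 < T)%N ->
  let A := slab_diff M i c r T in
  (2 * cnt A (fun y => (nb (i, false) y \notin A) && (M y != M (nb (i, false) y))) +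
   \sum_(k : dir n | k.1 != i) cnt A (fun y => (nb k y \notin A) && (M y != M (nb k y))) <=
   \sum_(k : dir n | k.1 != i) cnt A (fun y => (nb k y \notin A) && (M y == M (nb k y))))%N.
Proof.
move=> Mf T0; rewrite /=; set A := slab_diff _ _ _ _ _.
have := Mf A; rewrite (sum_dir i) [leqRHS](sum_dir i).
have -> : cnt A (fun y => (nb (i, true) y \notin A) && (M y == M (nb (i, true) y))) = 0%N.
  apply/eqP; rewrite cnt_sum big_seq big1 // => y yA.
  by apply/eqP; rewrite eqb0; apply/negP => /andP[/(slab_diff_up T0 yA)/negPf ->].
have -> : cnt A (fun y => (nb (i, true) y \notin A) && (M y != M (nb (i, true) y))) =
          cnt A (fun y => nb (i, true) y \notin A).
  apply: eq_cnt => y yA; case: (boolP (_ \in A)) => //= yA'.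
  exact: slab_diff_up yA yA'.
rewrite exit_balance (cntID _ _ (fun y => M y == M (nb (opp_dir (i, true)) y))) /=.
by rewrite /opp_dir /=; lia.
Qed.

Definition lateral_bd n (M : pred (zlat n)) (Q : {fset zlat n}) (k : dir n) : pred (zlat n) :=
  fun y => (nb k y \in Q) && (M y != M (nb k y)).

Lemma setc_shift n (i : 'I_n) (c y : zlat n) r T t :
  y \in slab i c r t ->
  exists j : 'I_(2 * t).+1, y = setc i (c 0 i - t%:Z + (j : nat)%:Z) (setc i T y).
Proof.
move=> /in_slab ys; have jt : (absz (y 0 i - c 0 i + t%:Z)%R < (2 * t).+1)%N.
  by have := ys i; rewrite eqxx; lia.
exists (Ordinal jt); apply/rowP => j; rewrite setc_setc setcE /=.
by case: (eqVneq j i) => [->|//]; have := ys i; rewrite eqxx; lia.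
Qed.

Lemma slab_project n (M : pred (zlat n)) i (c : zlat n) r t (T : int) k (P : pred (zlat n)) :
  k.1 != i ->
  (forall y, y \in slab i c r t -> P y ->
     nb k y \in slab i c r t /\ M (setc i (c 0 i + T) y) != M (setc i (c 0 i + T) (nb k y))) ->
  (cnt (slab i c r t) P <=
   (2 * t).+1 * cnt (level i c r T) (lateral_bd M (level i c r T) k))%N.
Proof.
move=> ki PM.
apply: leq_trans (leq_cnt_cover (K := 'I_(2 * t).+1) (B := fun=> level i c r T)
  (Q := fun=> lateral_bd M (level i c r T) k)
  (f := fun j y => setc i (c 0 i - t%:Z + (j : nat)%:Z) y) _) _; last first.
  by rewrite sum_nat_const card_ord.
move=> y ys Py; have [j yj] := setc_shift (c 0 i + T) ys.
have [ns Mn] := PM y ys Py.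
exists j, (setc i (c 0 i + T) y); split=> //; first exact: setc_level ys.
by rewrite /lateral_bd nb_setc // Mn andbT; apply: setc_level ns.
Qed.

(** The exit points lie on one face, and each spans a line of 2 r + 1 points across the slab. The
    product form avoids the exponent n - 2. *)
Lemma lateral_exit n i (c : zlat n) r t (k : dir n) : k.1 != i ->
  (cnt (slab i c r t) (fun y => nb k y \notin slab i c r t) * (2 * r).+1 <=
   (2 * t).+1 * (2 * r).+1 ^ n.-1)%N.
Proof.
move=> ki; rewrite -(card_slab i c).
have ex w : w \in [fset y in slab i c r t | nb k y \notin slab i c r t]%fset ->
    w \in slab i c r t /\ w 0 k.1 = c 0 k.1 + sg k.2 * r%:Z.
  rewrite in_cnt => /andP[ws]; rewrite (nb_slab ki ws) nbE eqxx => wN; split=> //.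
  by move/in_slab: ws => /(_ k.1); rewrite (negPf ki); move: wN; case: k.2; rewrite /sg /=; lia.
apply: (leq_card_columns (f := fun w (j : 'I_(2 * r).+1) => setc k.1 (c 0 k.1 - r%:Z + (j : nat)%:Z) w)).
  move=> w j /ex[/in_slab ws _]; apply/in_slab => j'; rewrite setcE.
  by case: (eqVneq j' k.1) => [->|_]; rewrite ?(negPf ki) //; have := ltn_ord j; lia.
move=> w w' j j' /ex[_ wE] /ex[_ wE'] /rowP e; split.
  apply/rowP => l; have := e l; rewrite !setcE.
  by case: (eqVneq l k.1) => [->|//]; rewrite wE wE'.
by apply/val_inj; have := e k.1; rewrite !setcE eqxx /=; lia.
Qed.

(** If both ends are in the slab and agree in [M] but only one is in [A], their projections to the
    upper level disagree; each projection has 2 T - 1 heights above it. The remaining exits leave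
    the slab. *)
Lemma slab_diff_lateral n (M : pred (zlat n)) i (c : zlat n) r T k : (0 < T)%N -> k.1 != i ->
  let A := slab_diff M i c r T in
  (cnt A (fun y => (nb k y \notin A) && (M y == M (nb k y))) <=
   (2 * T) * cnt (level i c r T) (lateral_bd M (level i c r T) k) +
   cnt (slab i c r T.-1) (fun y => nb k y \notin slab i c r T.-1))%N.
Proof.
move=> T0 ki /=; set A := slab_diff _ _ _ _ _.
pose P y := [&& y \in A, nb k y \notin A, M y == M (nb k y) & nb k y \in slab i c r T.-1].
apply: (@leq_trans (cnt (slab i c r T.-1) P +
   cnt (slab i c r T.-1) (fun y => nb k y \notin slab i c r T.-1)%N)).
  apply: leq_trans (cntU (Q := P) (R := fun y => nb k y \notin slab i c r T.-1) _) _.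
    by move=> y yA /andP[h1 h2]; rewrite /P yA h1 h2 /=; case: (_ \in slab _ _ _ _).
  by rewrite leq_add //; apply: (@leq_cnt_inj _ _ _ _ _ _ id) => // y;
    rewrite in_slab_diff => /andP[-> _].
rewrite leq_add2r; apply: leq_trans (slab_project (M := M) (T := T%:Z) ki _) _; last first.
  by rewrite leq_mul2r; apply/orP; right; lia.
move=> y ys; rewrite /P !in_slab_diff => /and4P[/andP[_ My] nA /eqP e ns]; split=> //.
by move: nA My; rewrite ns -e /=; do 3! case: (M _).
Qed.

(** A lateral boundary edge near the middle either has one end in [A], and is then an exit of [A] in
    direction k or its opposite, or projects to a boundary edge of the upper level, which happens
    for at most 3 heights. *)
Lemma near_level n (M : pred (zlat n)) i (c : zlat n) r T k : (1 < T)%N -> k.1 != i ->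
  let A := slab_diff M i c r T in
  let L := fun k => cnt A (fun y => (nb k y \notin A) && (M y != M (nb k y))) in
  (cnt (slab i c r 1) (lateral_bd M (slab i c r 1) k) <=
   L k + L (opp_dir k) + 3 * cnt (level i c r T) (lateral_bd M (level i c r T) k))%N.
Proof.
move=> T1 ki /=; set A := slab_diff _ _ _ _ _.
have sub : {subset slab i c r 1 <= slab i c r T.-1}.
  move=> y /in_slab ys; apply/in_slab => j; have := ys j.
  by case: (j == i); lia.
have inA y : y \in slab i c r 1 -> (y \in A) = (M y != M (setc i (c 0 i + T%:Z) y)).
  by move=> ys; rewrite in_slab_diff sub.
apply: leq_trans (cntU (Q := fun y => lateral_bd M (slab i c r 1) k y && ((y \in A) != (nb k y \in A)))
  (R := fun y => lateral_bd M (slab i c r 1) k y && ((y \in A) == (nb k y \in A))) _) _.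
  by move=> y _ ->; case: eqP.
apply: leq_add; last first.
  apply: (slab_project (M := M) (t := 1) (T := T%:Z) ki) => y ys /andP[/andP[ns Mn]]; rewrite !inA // => e.
  by split=> //; move: e Mn; do 4! case: (M _).
apply: leq_trans (cntU (Q := fun y => [&& y \in A, nb k y \notin A & M y != M (nb k y)])
  (R := fun y => [&& y \notin A, nb k y \in A & M y != M (nb k y)]) _) _.
  by move=> y _ /andP[/andP[_ ->]]; case: (y \in A); case: (_ \in A).
apply: leq_add.
  by apply: (@leq_cnt_inj _ _ _ _ _ _ id) => // y _ /and3P[-> -> ->].
apply: (@leq_cnt_inj _ _ _ _ _ _ (nb k)) => [y _ /and3P[nA -> e]|y z _ _ _ _]; last exact: nb_inj.
by rewrite nbK nA eq_sym.
Qed.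

(** On the way from p to a missing corner the vertical step, if any, can come first, as that
    neighbour is in [M]; the step leaving [M] is then lateral. *)
Lemma thin_lateral_bd n (M : pred (zlat n)) i b (c p : zlat n) r : (0 < r)%N ->
  p \in level i c r 0 -> thin M p -> M (nb (i, b) p) ->
  exists (z : zlat n) k (o : {ffun 'I_n -> 'I_3}), [/\ z \in slab i c r 1, k.1 != i,
    lateral_bd M (slab i c r 1) k z & p = \row_l (z 0 l + (o l : nat)%:Z - 1)].
Proof.
move=> r0 /in_level[pi pr] Sp Mb.
have Mp : M p by case/andP: Sp.
(* Lateral signs point towards c, so that the corners stay in the slab. *)
pose t j := if j == i then b else p 0 j <= c 0 j.
have ti : t i = b by rewrite /t eqxx.
have [I MI] := thin_corner t Sp.
suff [q [J [j [[qp iJ] ji jJ MJ MjJ]]]] : exists (q : zlat n) (J : {set 'I_n}) j,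
    [/\ (q = p \/ q = nb (i, b) p) /\ i \notin J, j != i, j \notin J, M (corner t J q) &
    ~~ M (nb (j, t j) (corner t J q))].
  have qi : - 1 <= q 0 i - p 0 i <= 1.
    case: qp => ->; first by clear; lia.
    by rewrite nbE eqxx /sg /=; clear; case: b; lia.
  have ql l : l != i -> q 0 l = p 0 l.
    by case: qp => ->; rewrite ?nbE => // /negPf li; rewrite li addr0.
  have cslab (J' : {set 'I_n}) : i \notin J' -> corner t J' q \in slab i c r 1.
    move=> iJ'; apply/in_slab => l; rewrite cornerE.
    case: (eqVneq l i) => [->|li] /=.
      by rewrite (negPf iJ') addr0; move: qi; rewrite pi; clear; lia.
    rewrite ql //; have := pr l li; rewrite /t (negPf li) /sg; clear -r0.
    by case: (l \in J'); [case: ifP|]; lia.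
  have off l : -1 <= p 0 l - corner t J q 0 l <= 1.
    rewrite cornerE; case: (eqVneq l i) => [->|/ql ->].
      by rewrite (negPf iJ); move: qi; clear; lia.
    by rewrite /sg; clear; case: (l \in J); case: (t l); lia.
  have off3 l : (absz (p 0%R l - corner t J q 0%R l + 1)%R < 3)%N by have := off l; clear; lia.
  exists (corner t J q), (j, t j), [ffun l => Ordinal (off3 l)].
  split=> //; first exact: cslab.
    rewrite /lateral_bd nb_corner // cslab; last by rewrite !inE negb_or eq_sym ji.
    by rewrite -nb_corner // MJ (negPf MjJ).
  by apply/rowP => l; rewrite mxE ffunE /=; have := off l; clear; lia.
have [iI|iI] := boolP (i \in I).
  have cE : corner t I p = corner t (I :\ i) (nb (i, b) p).
    apply/rowP => l; rewrite !cornerE nbE !inE /=.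
    by case: (eqVneq l i) => [->|_]; rewrite ?iI ?ti ?addr0.
  rewrite cE in MI; have [J [j [JI jI jJ MJ MjJ]]] := corner_path Mb MI.
  exists (nb (i, b) p), J, j; split=> //.
    by split; [right | apply/negP => /(fintype.subsetP JI); rewrite !inE eqxx].
  by move: jI; rewrite !inE => /andP[].
have [J [j [JI jI jJ MJ MjJ]]] := corner_path Mp MI.
exists p, J, j; split=> //.
  by split; [left | apply: contra iI => /(fintype.subsetP JI)].
by apply: contraNneq iI => <-.
Qed.

(** A thin point with both vertical neighbours outside [M] yields a downward boundary exit of [A],
    based at it or just above it according to the upper level. Any other thin point is near a
    lateral boundary edge. *)
Lemma thin_level n (M : pred (zlat n)) i (c : zlat n) r T : (0 < r)%N -> (1 < T)%N ->
  let A := slab_diff M i c r T in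
  (cnt (level i c r 0) (thin M) <=
   2 * cnt A (fun y => (nb (i, false) y \notin A) && (M y != M (nb (i, false) y))) +
   3 ^ n * \sum_(k : dir n | k.1 != i) cnt (slab i c r 1) (lateral_bd M (slab i c r 1) k))%N.
Proof.
move=> r0 T1 /=; set A := slab_diff _ _ _ _ _.
pose iso y := ~~ M (nb (i, true) y) && ~~ M (nb (i, false) y).
apply: leq_trans (cntU (Q := fun y => thin M y && iso y) (R := fun y => thin M y && ~~ iso y) _) _.
  by move=> y _ ->; case: iso.
apply: leq_add.
  apply: leq_trans (leq_cnt_cover (K := bool) (B := fun=> A)
    (Q := fun=> (fun y => (nb (i, false) y \notin A) && (M y != M (nb (i, false) y))))
    (f := fun b y => if b then nb (i, false) y else y) _) _; last first.
    by rewrite sum_nat_const card_bool.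
  move=> p /in_level[pi pr] /andP[/andP[Mp _] /andP[Mt Mf]].
  have sp : p \in slab i c r T.-1.
    by apply/in_slab => j; case: (eqVneq j i) => [->|/pr]; lia.
  have top b y : setc i (c 0 i + T%:Z) (nb (i, b) y) = setc i (c 0 i + T%:Z) y.
    by apply/rowP => j; rewrite !setcE nbE /=; case: (j == i); rewrite ?addr0.
  have snb : nb (i, true) p \in slab i c r T.-1.
    by apply/in_slab => j; rewrite nbE /=; case: (eqVneq j i) => [->|/pr]; rewrite /sg; lia.
  have [Mtop|Mtop] := boolP (M (setc i (c 0 i + T%:Z) p)).
    exists true, (nb (i, true) p).
    have -> : nb (i, false) (nb (i, true) p) = p by rewrite (nbK (i, true)).
    by rewrite !in_slab_diff snb sp top Mtop (negPf Mt) Mp.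
  exists false, p; rewrite !in_slab_diff sp top Mp (negPf Mtop) (negPf Mf) /=.
  by rewrite andbF.
apply: leq_trans (leq_cnt_cover (K := ({ffun 'I_n -> 'I_3} * dir n)%type)
  (B := fun=> slab i c r 1)
  (Q := fun ok y => (ok.2.1 != i) && lateral_bd M (slab i c r 1) ok.2 y)
  (f := fun ok y => \row_j (y 0 j + (ok.1 j : nat)%:Z - 1)) _) _; last first.
  rewrite -(pair_bigA _ (fun o k => cnt (slab i c r 1)
    (fun y => (k.1 != i) && lateral_bd M (slab i c r 1) k y))) /=.
  rewrite sum_nat_const card_ffun !card_ord leq_mul2l; apply/orP; right.
  rewrite [leqRHS]big_mkcond /=; apply: leq_sum => k _; case: ifP => ki //.
  by rewrite cnt_sum big1.
move=> p pl /andP[Sp niso].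
have [b Mb] : exists b, M (nb (i, b) p).
  by move: niso; rewrite negb_and !negbK => /orP[]; [exists true | exists false].
have [z [k [o [zs ki kz pz]]]] := thin_lateral_bd r0 pl Sp Mb.
by exists (o, k), z; split; rewrite //= ki.
Qed.

(** * A level with few lateral boundary edges *)

Lemma leq_sum_range a b (F G : nat -> nat) :
  (forall t, (a <= t < b)%N -> (F t <= G t)%N) ->
  (\sum_(a <= t < b) F t <= \sum_(a <= t < b) G t)%N.
Proof. by move=> FG; rewrite big_nat [leqRHS]big_nat; apply: leq_sum. Qed.

(* Dyadic form of the divergence of the harmonic series. *)
Lemma harmonic_pigeonhole (f : nat -> nat) q B P m : (0 < P)%N -> (2 * q * B + 1 < m)%N ->
  (\sum_(0 <= t < 2 ^ m) f t <= B * P)%N ->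
  exists t, [/\ (1 < t)%N, (t < 2 ^ m)%N & (q * t * f t <= P)%N].
Proof.
move=> P0 qBm fB; apply/not_existsP => no.
have big t : (1 < t)%N -> (t < 2 ^ m)%N -> (P < q * t * f t)%N.
  by move=> t1 t2; rewrite ltnNge; apply/negP => le; apply: (no t).
(* Each new dyadic block has 2^(k+1) terms above P / (q 2^(k+2)), hence contributes at least P / (2
   q). *)
have claim k : (k < m)%N -> (k * P <= 2 * q * \sum_(2 <= t < 2 ^ k.+1) f t)%N.
  elim: k => [|k IHk] km; first by rewrite mul0n.
  have k2 : (2 <= 2 ^ k.+1)%N by rewrite expnS leq_pmulr ?expn_gt0.
  rewrite (@big_cat_nat _ _ _ (2 ^ k.+1)) //=; last by rewrite leq_exp2l.
  rewrite mulnDr mulSn addnC leq_add //; first by apply: IHk; apply: ltnW.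
  rewrite -(@leq_pmul2l (2 ^ k.+1)) ?expn_gt0 //.
  have -> : (2 ^ k.+1 * P = \sum_(2 ^ k.+1 <= t < 2 ^ k.+2) P)%N.
    by rewrite sum_nat_const_nat [(2 ^ k.+2)%N]expnS mul2n -addnn addnK.
  rewrite mulnA big_distrr /=; apply: leq_sum_range => t /andP[t1 t2].
  have tm : (t < 2 ^ m)%N by apply: leq_trans t2 _; rewrite leq_exp2l.
  apply: leq_trans (ltnW (big t (leq_trans k2 t1) tm)) _.
  rewrite leq_mul2r; apply/orP; right.
  by rewrite mulnCA mulnA -expnS mulnC leq_mul2r (ltnW t2) orbT.
have m0 : (0 < m)%N by apply: leq_ltn_trans qBm.
have := claim m.-1; rewrite prednK // => /(_ (leqnn _)) h.
have h2 : (\sum_(2 <= t < 2 ^ m) f t <= B * P)%N.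
  apply: leq_trans fB; rewrite [leqRHS](@big_cat_nat _ _ _ 2) //= ?leq_addl //.
  by rewrite -(prednK m0) expnS leq_pmulr ?expn_gt0.
have : (m.-1 * P <= 2 * q * B * P)%N.
  by apply: (leq_trans h); rewrite -[leqRHS]mulnA leq_mul2l h2 orbT.
by rewrite leq_pmul2r //; lia.
Qed.

Definition level_bd n (M : pred (zlat n)) i (c : zlat n) r (t : nat) : nat :=
  (\sum_(k : dir n | k.1 != i) cnt (level i c r t) (lateral_bd M (level i c r t) k))%N.

(** The levels 0 to 2 r stack up to a ball of radius [r]; [perimeter_bound] is used there for [M]
    and for its complement. *)
Lemma level_bd_sum n (M : pred (zlat n)) i (c : zlat n) r : flip_minimal M ->
  (\sum_(0 <= t < (2 * r).+1) level_bd M i c r t <= 2 * 3 ^ n * (2 * r).+1 ^ n.-1)%N.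
Proof.
move=> Mf; have n0 : (0 < n)%N := leq_trans (ltn0Sn _) (ltn_ord i).
pose x := setc i (c 0 i + r%:Z) c.
apply: (@leq_trans (\sum_(k : dir n) cnt (cball x r) (fun y => M y != M (nb k y)))%N); last first.
  rewrite -mulnA mul2n -addnn.
  apply: leq_trans (leq_add (perimeter_bound x r Mf n0) (perimeter_bound x r (flip_minimalC Mf) n0)).
  rewrite -big_split /=; apply: leq_sum => k _; apply: cntU => y _.
  by case: (M y); case: (M _).
rewrite exchange_big /= [leqRHS](bigID (fun k : dir n => k.1 != i)) /=.
apply: leq_trans (leq_addr _ _); apply: leq_sum => k ki.
apply: (@leq_trans (\sum_(0 <= t < (2 * r).+1)
  cnt (cball x r) (fun y => (y 0%R i == (c 0 i + t%:Z)%R) && (M y != M (nb k y)))%N)%N).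
  apply: leq_sum_range => t /andP[_ tr]; apply: (@leq_cnt_inj _ _ _ _ _ _ id) => // y.
  move=> /in_level[yi yr] /andP[_ ->]; rewrite yi eqxx !andbT; apply/in_ball => j.
  rewrite /x setcE; case: (eqVneq j i) => [->|/yr]; lia.
under eq_bigr do rewrite cnt_sum.
rewrite exchange_big /= cnt_sum; apply: leq_sum => y _.
case: (M y != M (nb k y)); last by rewrite big1 // => t _; rewrite andbF.
have [[t /eqP yt]|no] := pselect (exists t : nat, y 0 i == c 0 i + t%:Z).
  have [tr|tr] := ltnP t (2 * r).+1.
    rewrite (bigD1_seq t) ?iota_uniq ?mem_index_iota //= big1 => [|u ut].
      by rewrite yt eqxx.
    by rewrite yt andbT; apply/eqP; rewrite eqb0; apply: contra ut => /eqP; lia.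
  rewrite big_nat big1 // => u /andP[_ ur]; rewrite andbT yt; apply/eqP; rewrite eqb0.
  by apply/eqP; lia.
rewrite big1 // => t _; rewrite andbT; apply/eqP; rewrite eqb0; apply/negP => yt.
by apply: no; exists t.
Qed.

(** At the level T given by [harmonic_pigeonhole], T times the lateral boundary is small.
    [slab_flip] then makes the downward boundary exits and the lateral boundary edges near the
    middle few, and [thin_level] charges the thin points to these. *)
Lemma thin_plane n q : exists r0, forall (M : pred (zlat n)) i (c : zlat n) r,
  flip_minimal M -> (r0 <= r)%N ->
  (q * cnt (level i c r 0) (thin M) <= (2 * r).+1 ^ n.-1)%N.
Proof.
pose C := (3 ^ n * (7 + 4 * n))%N; pose q' := (q * C)%N; pose B := (2 * 3 ^ n)%N.
(* The first summand of the radius makes the lateral exits of the slab negligible; the second keeps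
   the candidate levels among the 2 r + 1 available ones. *)
pose m := (2 * q' * B).+2; exists (2 ^ m * q' + 2 ^ m)%N => M i c r Mf rr.
have C0 : (0 < C)%N by rewrite muln_gt0 expn_gt0.
have m0 : (0 < 2 ^ m)%N by rewrite expn_gt0.
have r0 : (0 < r)%N by apply: leq_trans rr; rewrite addn_gt0 m0 orbT.
set P := ((2 * r).+1 ^ n.-1)%N; have P0 : (0 < P)%N by rewrite expn_gt0.
have [T [T1 Tm qT]] : exists t, [/\ (1 < t)%N, (t < 2 ^ m)%N & (q' * t * level_bd M i c r t <= P)%N].
  apply: (@harmonic_pigeonhole _ _ B) => //; first by rewrite /m; clear; lia.
  apply: leq_trans (level_bd_sum i c r Mf).
  rewrite [leqRHS](@big_cat_nat _ _ _ (2 ^ m)) //= ?leq_addr //.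
  by apply: leq_trans (leq_trans _ rr) _; rewrite ?leq_addl //; clear; lia.
have T0 : (0 < T)%N by apply: ltnW.
pose e k := cnt (slab i c r T.-1) (fun y => nb k y \notin slab i c r T.-1).
have ek k : k.1 != i -> (q' * e k <= P)%N.
  move=> ki; have := lateral_exit c r T.-1 ki; rewrite -/(e k) -/P => h.
  have mm : (0 < 2 * 2 ^ m)%N by rewrite muln_gt0.
  rewrite -(leq_pmul2l mm); apply: (@leq_trans (e k * (2 * r).+1)%N).
    by rewrite mulnA [leqRHS]mulnC leq_mul2r; apply/orP; right; move: rr; clear; lia.
  apply: (leq_trans h); rewrite leq_mul2r; apply/orP; right.
  by move: Tm; clear; lia.
have := slab_flip i c r Mf T0; have := thin_level M i c r0 T1.
rewrite /=; set A := slab_diff _ _ _ _ _.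
set f := cnt A _; set beta := (\sum_(_ | _) _)%N; set LL := (\sum_(_ | _) _)%N.
set RR := (\sum_(_ | _) _)%N => hthin hflip.
set a := level_bd M i c r T in qT.
pose E := (\sum_(k : dir n | k.1 != i) e k)%N.
have hRR : (RR <= 2 * T * a + E)%N.
  rewrite /RR /a /level_bd big_distrr /= /E -big_split /=; apply: leq_sum => k ki.
  exact: slab_diff_lateral T0 ki.
have hbeta : (beta <= 2 * LL + 3 * a)%N.
  pose L k := cnt A (fun y => (nb k y \notin A) && (M y != M (nb k y))).
  have -> : (2 * LL = \sum_(k : dir n | k.1 != i) (L k + L (opp_dir k)))%N.
    rewrite mul2n -addnn big_split /=; congr (_ + _)%N.
    by rewrite /LL (reindex_inj (can_inj (@opp_dirK n))).
  rewrite /a /level_bd big_distrr /= -big_split /=; apply: leq_sum => k ki.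
  exact: near_level T1 ki.
have hE : (q' * E <= 2 * n * P)%N.
  rewrite /E big_distrr /=; apply: (@leq_trans (\sum_(k : dir n) P)%N).
    by rewrite big_mkcond /=; apply: leq_sum => k _; case: ifP => // /ek.
  by rewrite sum_nat_const card_prod card_ord card_bool [(n * 2)%N]mulnC.
have h3 : (0 < 3 ^ n)%N by rewrite expn_gt0.
set th := cnt _ _ in hthin *.
(* From 2 f + LL <= RR <= 2 T a + E and beta <= 2 LL + 3 a. *)
have h : (th <= 3 ^ n * (7 * (T * a) + 2 * E))%N.
  apply: (leq_trans hthin).
  apply: (@leq_trans (3 ^ n * (2 * f) + 3 ^ n * beta)%N); first by rewrite leq_add2r leq_pmull.
  rewrite -mulnDr leq_mul2l; apply/orP; right.
  have : (a <= T * a)%N by rewrite leq_pmull.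
  by move: hflip hRR hbeta; rewrite -!mulnA; clear; lia.
have : (q' * th <= C * P)%N.
  apply: leq_trans (leq_mul (leqnn q') h) _; rewrite mulnCA /C -mulnA leq_mul2l; apply/orP; right.
  rewrite mulnDr mulnDl !(mulnCA q'); move: qT hE; rewrite -!mulnA; clear; lia.
by rewrite /q' [(q * C)%N]mulnC -mulnA leq_pmul2l.
Qed.

(** * Filling a small complement *)

Definition hole n (M : pred (zlat n)) (x : zlat n) r : {fset zlat n} :=
  [fset y in cball x r | ~~ M y]%fset.

Lemma in_hole n (M : pred (zlat n)) (x y : zlat n) r :
  (y \in hole M x r) = (y \in cball x r) && ~~ M y.
Proof. by rewrite in_cnt. Qed.

Definition inward n (M : pred (zlat n)) (x : zlat n) r (k : dir n) : pred (zlat n) :=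
  fun z => (nb k z \in cball x r) && M (nb k z).

Definition clear_behind n (M : pred (zlat n)) (x : zlat n) r (k : dir n) : pred (zlat n) :=
  fun z => `[< forall v, setc k.1 v z \in cball x r -> sg k.2 * v <= sg k.2 * z 0 k.1 ->
    ~~ M (setc k.1 v z) >].

Definition back_face n (x : zlat n) r (k : dir n) : pred (zlat n) :=
  fun z => z 0 k.1 == x 0 k.1 - sg k.2 * r%:Z.

Definition clear_line n (M : pred (zlat n)) (x : zlat n) r (k : dir n) : pred (zlat n) :=
  fun z => `[< forall v, setc k.1 v z \in cball x r -> ~~ M (setc k.1 v z) >].

Lemma setc_cball n (x z : zlat n) r i v : z \in cball x r ->
  (setc i v z \in cball x r) = (- r%:Z <= v - x 0 i <= r%:Z).
Proof.
move=> /in_ball zr; apply/in_ball/idP => [/(_ i)|vr j]; first by rewrite setcE eqxx.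
by rewrite setcE; case: (eqVneq j i) => [->|_ //].
Qed.

Lemma nb_line n (k : dir n) (z : zlat n) : nb k z = setc k.1 (z 0 k.1 + sg k.2) z.
Proof.
by apply/rowP => j; rewrite nbE setcE; case: (eqVneq j k.1) => [->|_]; rewrite ?addr0.
Qed.

(** Follow the line from the back face to its first point of [M], if any: the point just before it
    is inward and clear behind, and determines the line. *)
Lemma back_face_count n (M : pred (zlat n)) (x : zlat n) r k :
  let T := hole M x r in
  (cnt T (back_face x r k) <=
   cnt T (fun z => inward M x r k z && clear_behind M x r k z) +
   cnt T (fun z => back_face x r k z && clear_line M x r k z))%N.
Proof.
rewrite /= addnC (cntID _ (back_face x r k) (clear_line M x r k)) leq_add2l.
apply: leq_trans (leq_cnt_cover (K := unit) (B := fun=> hole M x r)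
  (Q := fun=> (fun z => inward M x r k z && clear_behind M x r k z))
  (f := fun _ z => setc k.1 (x 0 k.1 - sg k.2 * r%:Z) z) _) _; last first.
  by rewrite sum_nat_const card_unit mul1n.
move=> w; rewrite in_hole => /andP[wB wM] /andP[/eqP wf /asboolPn].
pose g (j : nat) : zlat n := setc k.1 (w 0 k.1 + sg k.2 * j%:Z) w.
have gB j : (j <= 2 * r)%N -> g j \in cball x r.
  by move=> jr; rewrite setc_cball // wf; case: k.2; rewrite /sg; move: jr; clear; lia.
move=> notclear.
have [j0 /andP[j0r Mj0]] : exists j, (j <= 2 * r)%N && M (g j).
  apply/not_existsP => no; apply: notclear => v vB; apply/negP => Mv.
  rewrite setc_cball // in vB.
  apply: (no (absz (v - w 0%R k.1)%R)); apply/andP; split.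
    by move: vB; rewrite wf; case: k.2; rewrite /sg; clear; lia.
  suff -> : g (absz (v - w 0%R k.1)%R) = setc k.1 v w by [].
  rewrite /g; congr (setc _ _ _); move: vB; rewrite wf; case: k.2; rewrite /sg; clear; lia.
have exj : exists j, (j <= 2 * r)%N && M (g j) by exists j0; rewrite j0r.
case: (ex_minnP exj) => j /andP[jr Mj] jmin.
have j_gt0 : (0 < j)%N.
  rewrite lt0n; apply: contraNneq wM => j0'; move: Mj; rewrite j0' /g mulr0 addr0.
  by rewrite setc_id.
have before i : (i < j)%N -> ~~ M (g i).
  move=> ij; apply/negP => Mi; have := jmin i; rewrite Mi andbT.
  by move: ij jr; clear; lia.
have nbg : nb k (g j.-1) = g j.
  rewrite nb_line /g setc_setc setcE eqxx; congr (setc _ _ _).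
  by move: j_gt0; case: k.2; rewrite /sg; clear; lia.
exists tt, (g j.-1); split.
- rewrite in_hole gB ?before //; first by rewrite prednK.
  by apply: leq_trans jr; apply: leq_pred.
- rewrite /inward nbg Mj gB //=; apply/asboolP => v; rewrite /g setc_setc setcE eqxx => vB vle.
  rewrite setc_cball // in vB.
  suff [i ij ->] : exists2 i, (i < j)%N & setc k.1 v w = g i by apply: before.
  exists (absz (v - w 0%R k.1)%R).
    by move: vB vle j_gt0; rewrite wf; case: k.2; rewrite /sg; clear; lia.
  rewrite /g; congr (setc _ _ _); move: vB; rewrite wf; case: k.2; rewrite /sg; clear; lia.
- by rewrite /g setc_setc -wf setc_id.
Qed.

(* Each point of the complement on the back face starts a line that either avoids [M]
   or first meets it through an inward edge with nothing of [M] behind; minimality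
   bounds all inward edges by the points on the back faces. *)
Lemma inward_excess n (M : pred (zlat n)) (x : zlat n) r : flip_minimal M ->
  let T := hole M x r in
  (\sum_(k : dir n) cnt T (fun z => inward M x r k z && ~~ clear_behind M x r k z) <=
   \sum_(k : dir n) cnt T (fun z => back_face x r k z && clear_line M x r k z))%N.
Proof.
move=> Mf /=; set T := hole M x r.
have := @flip_remove n _ T (flip_minimalC Mf) => /(_ _)/wrap[y|]; first by rewrite in_hole => /andP[].
move=> fl.
(* Filling the hole, edges into [M] are at most the edges to points outside both [M] and the hole.
   The latter leave the ball, so they start on the back face of the opposite direction. *)
have h1 : (\sum_(k : dir n) cnt T (inward M x r k) <=
           \sum_(k : dir n) cnt T (back_face x r k))%N.
  apply: (@leq_trans (\sum_(k : dir n) cnt T (fun y => ~~ ~~ M (nb k y)))%N).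
    by apply: leq_sum => k _; apply: leq_cnt => z _ /andP[_ ->].
  apply: (leq_trans fl); rewrite [leqRHS](reindex_inj (can_inj (@opp_dirK n))) /=.
  apply: leq_sum => k _; apply: leq_cnt => z; rewrite in_hole => /andP[zB zM] /andP[zkM].
  rewrite in_hole zkM andbT nb_line setc_cball // /back_face /= => zk.
  move/in_ball: zB => /(_ k.1); move: zk; clear; case: k.2; rewrite /sg /=; lia.
have h2 : (\sum_(k : dir n) cnt T (inward M x r k) =
    \sum_(k : dir n) cnt T (fun z => inward M x r k z && clear_behind M x r k z) +
    \sum_(k : dir n) cnt T (fun z => inward M x r k z && ~~ clear_behind M x r k z))%N.
  by rewrite -big_split /=; apply: eq_bigr => k _; apply: cntID.
have : (\sum_(k : dir n) cnt T (back_face x r k) <=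
  \sum_(k : dir n) (cnt T (fun z => inward M x r k z && clear_behind M x r k z) +
    cnt T (fun z => back_face x r k z && clear_line M x r k z)))%N.
  by apply: leq_sum => k _; apply: back_face_count.
by move/(leq_trans h1); rewrite h2 big_split /= leq_add2l.
Qed.

Lemma clear_line_count n (M : pred (zlat n)) (x : zlat n) r k :
  (cnt (hole M x r) (fun z => back_face x r k z && clear_line M x r k z) * (2 * r).+1 <=
   #|` hole M x r|)%N.
Proof.
apply: (leq_card_columns (f := fun w (j : 'I_(2 * r).+1) => setc k.1 (x 0 k.1 - r%:Z + (j : nat)%:Z) w)).
  move=> w j; rewrite in_cnt in_hole => /andP[/andP[wB _] /andP[_ /asboolP cl]].
  have sB : setc k.1 (x 0 k.1 - r%:Z + (j : nat)%:Z) w \in cball x r.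
    by rewrite setc_cball //; have := ltn_ord j; clear; lia.
  by rewrite in_hole sB cl.
move=> w w' j j'; rewrite !in_cnt => /andP[_ /andP[/eqP wf _]] /andP[_ /andP[/eqP wf' _]] /rowP e.
split; last by apply/val_inj; have := e k.1; rewrite !setcE eqxx /=; clear; lia.
apply/rowP => l; have := e l; rewrite !setcE.
by case: (eqVneq l k.1) => [->|//]; rewrite wf wf'.
Qed.

(** The right-hand side is the distance of z from the back face. *)
Definition deep n (x : zlat n) r (ell : nat) (k : dir n) : pred (zlat n) :=
  fun z => ell%:Z <= sg k.2 * (z 0 k.1 - x 0 k.1) + r%:Z.

(** Such a point ends a run of [ell] hole points, and each line carries at most one: a second one
    further on would have [M] behind it. *)
Lemma deep_count n (M : pred (zlat n)) (x : zlat n) r ell k :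
  (cnt (hole M x r) (fun z => [&& inward M x r k z, clear_behind M x r k z & deep x r ell k z]) * ell <=
   #|` hole M x r|)%N.
Proof.
apply: (leq_card_columns (f := fun (w : zlat n) (j : 'I_ell) => setc k.1 (w 0 k.1 - sg k.2 * (j : nat)%:Z) w)).
  have line (w : zlat n) (j : 'I_ell) : w \in cball x r -> clear_behind M x r k w ->
      deep x r ell k w -> setc k.1 (w 0 k.1 - sg k.2 * (j : nat)%:Z) w \in hole M x r.
    move=> wB /asboolP cb dp; have sB : setc k.1 (w 0 k.1 - sg k.2 * (j : nat)%:Z) w \in cball x r.
      rewrite setc_cball //; move/in_ball: wB => /(_ k.1); move: dp (ltn_ord j); rewrite /deep.
      by clear; case: k.2; rewrite /sg; lia.
    rewrite in_hole sB cb //.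
    by clear; case: k.2; rewrite /sg; lia.
  by move=> w j; rewrite in_cnt in_hole => /andP[/andP[wB wM] /and3P[_ cb dp]]; apply: line.
have key (w w' : zlat n) : inward M x r k w -> clear_behind M x r k w' ->
    (forall l, l != k.1 -> w 0 l = w' 0 l) -> sg k.2 * w' 0 k.1 <= sg k.2 * w 0 k.1.
  move=> /andP[nB Mn] /asboolP cb ww; rewrite leNgt; apply/negP => lt.
  have nE : nb k w = setc k.1 (w 0 k.1 + sg k.2) w'.
    apply/rowP => l; rewrite nbE setcE; case: (eqVneq l k.1) => [->//|/ww ->].
    by rewrite addr0.
  move: Mn; apply/negP; rewrite nE; apply: cb; first by rewrite -nE.
  by move: lt; clear; case: k.2; rewrite /sg; lia.
have last (w w' : zlat n) (j j' : 'I_ell) : w 0 k.1 = w' 0 k.1 ->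
    setc k.1 (w 0 k.1 - sg k.2 * (j : nat)%:Z) w 0 k.1 =
    setc k.1 (w' 0 k.1 - sg k.2 * (j' : nat)%:Z) w' 0 k.1 -> j = j'.
  move=> wk; rewrite !setcE eqxx wk => e; apply/val_inj; move: e => /=.
  by clear; case: k.2; rewrite /sg; lia.
move=> w w' j j'; rewrite !in_cnt => /andP[wT /and3P[iw cw _]] /andP[wT' /and3P[iw' cw' _]] /rowP e.
have ww l : l != k.1 -> w 0 l = w' 0 l.
  by move=> lk; have := e l; rewrite !setcE (negPf lk).
have wk : w 0 k.1 = w' 0 k.1.
  have := key w w' iw cw' ww; have := key w' w iw' cw (fun l lk => esym (ww l lk)).
  move=> h1 h2; have /mulfI : sg k.2 != 0 by case: k.2.
  by apply; apply/eqP; rewrite eq_le h1 h2.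
split; last exact: last wk (e k.1).
by apply/rowP => l; case: (eqVneq l k.1) => [->//|/ww].
Qed.

(** Otherwise all nearby inward edges are shallow. Signs pointing along them, or to the centre if
    there are none, keep the cube at p in the ball, and its missing corner gives an inward edge
    against the chosen sign. This contradicts the choice, or puts p near two opposite faces, which
    [ell < r] forbids. *)
Lemma thin_near_inward n (M : pred (zlat n)) (x p : zlat n) r ell : (ell < r)%N ->
  p \in cball x r -> thin M p ->
  exists (z : zlat n) k, [/\ z \in hole M x r, inward M x r k z,
    ~~ clear_behind M x r k z || deep x r ell k z & forall l, -1 <= p 0 l - z 0 l <= 1].
Proof.
move=> er pB Sp; apply/not_existsP => no0.
pose near (z : zlat n) := forall l, -1 <= p 0 l - z 0 l <= 1.
have no (z : zlat n) k : z \in hole M x r -> inward M x r k z -> near z ->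
    sg k.2 * (z 0 k.1 - x 0 k.1) + r%:Z < ell%:Z.
  move=> zT iz nz; rewrite ltNge; apply/negP => dz; apply: (no0 z); exists k; split=> //.
  by rewrite /deep dz orbT.
pose has_in i b := exists z : zlat n, [/\ z \in hole M x r, inward M x r (i, b) z & near z].
pose t i := if `[< has_in i true >] then true
            else if `[< has_in i false >] then false else p 0 i <= x 0 i.
have Mp : M p by case/andP: Sp.
have tr i : - r%:Z <= p 0 i + sg (t i) - x 0 i <= r%:Z.
  move/in_ball: pB => /(_ i); rewrite /t; case: asboolP => [[z [zT iz nz]]|_].
    by have := no z _ zT iz nz; have := nz i; move: er; rewrite /sg /=; clear; lia.
  case: asboolP => [[z [zT iz nz]]|_].
    by have := no z _ zT iz nz; have := nz i; move: er; rewrite /sg /=; clear; lia.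
  by move: er; rewrite /sg; clear; case: ifP; lia.
have cB (J : {set 'I_n}) : corner t J p \in cball x r.
  apply/in_ball => l; rewrite cornerE; case: (l \in J); first exact: tr.
  by rewrite addr0; move/in_ball: pB; apply.
have [I MI] := thin_corner t Sp.
have [J [i [_ _ iJ MJ MiJ]]] := corner_path Mp MI.
set y := corner t J p in MJ MiJ; set z := nb _ y in MiJ.
have zB : z \in cball x r by rewrite /z nb_corner.
have zT : z \in hole M x r by rewrite in_hole zB.
have nz : near z.
  move=> l; rewrite /z nb_corner // cornerE; case: (l \in _); rewrite /sg; [case: (t l)|]; clear; lia.
have iz : inward M x r (i, ~~ t i) z.
  by rewrite /inward (nbK (i, t i)) MJ cB.
have zi : has_in i (~~ t i) by exists z.
have := no z _ zT iz nz; move: zi; rewrite /t; case: asboolP => [[z' [zT' iz' nz']]|nt] /=.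
  move=> _; have := no z' _ zT' iz' nz'; have := nz i; have := nz' i; move: er.
  by rewrite /sg /=; clear; lia.
case: asboolP => [|nf] //.
by case: (p 0 i <= x 0 i).
Qed.

(** By [inward_excess] the inward edges not clear behind are at most as many as the clear lines;
    clear lines and deep edges each account for [ell] hole points. The factor 4 n is two families
    over 2 n directions. *)
Lemma thin_hole_count n (M : pred (zlat n)) (x : zlat n) r ell :
  flip_minimal M -> (ell < r)%N ->
  (cnt (cball x r) (thin M) * ell <= 3 ^ n * (4 * n) * #|` hole M x r|)%N.
Proof.
move=> Mf er; set T := hole M x r.
pose bad k z := inward M x r k z && (~~ clear_behind M x r k z || deep x r ell k z).
have h1 : (cnt (cball x r) (thin M) <= 3 ^ n * \sum_(k : dir n) cnt T (bad k))%N.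
  apply: leq_trans (leq_cnt_cover (K := ({ffun 'I_n -> 'I_3} * dir n)%type) (B := fun=> T)
    (Q := fun ok => bad ok.2)
    (f := fun ok y => \row_j (y 0 j + (ok.1 j : nat)%:Z - 1)) _) _; last first.
    rewrite -(pair_bigA _ (fun o k => cnt T (bad k))) /=.
    by rewrite sum_nat_const card_ffun !card_ord.
  have near3 (p z : zlat n) : (forall l, -1 <= p 0 l - z 0 l <= 1) ->
      exists o : {ffun 'I_n -> 'I_3}, p = \row_j (z 0 j + (o j : nat)%:Z - 1).
    move=> pz; have off3 l : (absz (p 0%R l - z 0%R l + 1)%R < 3)%N by have := pz l; clear; lia.
    exists [ffun l => Ordinal (off3 l)].
    by apply/rowP => l; rewrite mxE ffunE /=; have := pz l; clear; lia.
  move=> p pB Sp; have [z [k [zT iz bz pz]]] := thin_near_inward er pB Sp.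
  have [o po] := near3 _ _ pz.
  by exists (o, k), z; split; rewrite // /bad iz.
have h2 : (\sum_(k : dir n) cnt T (bad k) <=
   \sum_(k : dir n) (cnt T (fun z => back_face x r k z && clear_line M x r k z) +
     cnt T (fun z => [&& inward M x r k z, clear_behind M x r k z & deep x r ell k z])))%N.
  rewrite big_split /=; apply: leq_trans (leq_add (inward_excess x r Mf) (leqnn _)).
  rewrite -big_split /=; apply: leq_sum => k _; apply: cntU => z _.
  by rewrite /bad; case: (inward _ _ _ _ _); case: (clear_behind _ _ _ _ _).
have h3 : (\sum_(k : dir n) cnt T (bad k) * ell <= 4 * n * #|` T|)%N.
  rewrite -big_distrl /=; apply: leq_trans (leq_mul h2 (leqnn _)) _; rewrite big_distrl /=.
  apply: (@leq_trans (\sum_(k : dir n) 2 * #|` T|)%N).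
    apply: leq_sum => k _; rewrite mulnDl mul2n -addnn; apply: leq_add; last exact: deep_count.
    apply: leq_trans (clear_line_count M x r k); rewrite leq_mul2l; apply/orP; right.
    by move: er; clear; lia.
  by rewrite sum_nat_const card_prod card_ord card_bool mulnA -(mulnA n) (mulnC n).
rewrite -big_distrl /= in h3.
apply: leq_trans (leq_mul h1 (leqnn _)) _; rewrite -!mulnA leq_mul2l; apply/orP; right.
by rewrite mulnA.
Qed.

(** * The boundary ratio *)

Definition vbd n (M : pred (zlat n)) : pred (zlat n) :=
  fun y => M y && [exists k : dir n, ~~ M (nb k y)].

Lemma inner_edges_hole n (M : pred (zlat n)) (x : zlat n) r :
  (inner_edges (cball x r) (hole M x r) <= 2 * n * cnt (cball x r) (vbd M))%N.
Proof.
apply: (@leq_trans (\sum_(k : dir n) cnt (cball x r) (vbd M))%N).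
  apply: leq_sum => k _; apply: (@leq_cnt_inj _ _ _ _ _ _ (nb k)) => [z|y z _ _ _ _]; last exact: nb_inj.
  rewrite !in_hole => /andP[zB zM] /andP[nB]; rewrite nB /= negbK /vbd => -> /=.
  by apply/existsP; exists (opp_dir k); rewrite nbK.
by rewrite sum_nat_const card_prod card_ord card_bool [(n * 2)%N]mulnC.
Qed.

(** Each axis contributes at most one, by [cpart_nb]. *)
Lemma cpart_neighbors n (M : pred (zlat n)) (z : zlat n) : cpart M z ->
  (\sum_(k : dir n) ~~ cpart M (nb k z) <= n)%N.
Proof.
move=> Cz; rewrite -(pair_bigA _ (fun i b => nat_of_bool (~~ cpart M (nb (i, b) z)))) /=.
apply: (@leq_trans (\sum_(i < n) 1)%N); last by rewrite sum_nat_const card_ord muln1.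
apply: leq_sum => i _; rewrite big_bool; have [b] := cpart_nb i Cz.
by case: b => ->; case: (cpart M _).
Qed.

(** Remove the thin points of the ball. Their edges out of [M] are at most their edges to the rest
    of [M], which end in the cube part, at most n at each point, or leave the ball from a face. *)
Lemma thin_boundary n (M : pred (zlat n)) (x : zlat n) r : flip_minimal M ->
  (cnt (cball x r) (fun y => thin M y && vbd M y) <=
   n * cnt (cball x r) (vbd (cpart M)) +
   \sum_(k : dir n) cnt (level k.1 (setc k.1 (x 0%R k.1 + sg k.2 * r%:Z)%R x) r 0) (thin M))%N.
Proof.
move=> Mf; pose A := [fset y in cball x r | thin M y]%fset.
have inA y : (y \in A) = (y \in cball x r) && thin M y by rewrite in_cnt.
have := @flip_remove n M A Mf => /(_ _)/wrap[y|fl]; first by rewrite inA => /and3P[].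
apply: (@leq_trans (\sum_(k : dir n) cnt A (fun y => ~~ M (nb k y)))%N).
  apply: (leq_cnt_cover (f := fun _ y => y)) => y yB /andP[Sy /andP[_ /existsP[k kM]]].
  by exists k, y; rewrite inA yB.
apply: (leq_trans fl).
apply: (@leq_trans (\sum_(k : dir n) (cnt A (fun y => (nb k y \in cball x r) && cpart M (nb k y)) +
   cnt A (fun y => nb k y \notin cball x r)))%N).
  apply: leq_sum => k _; apply: cntU => y _ /andP[Mk]; rewrite inA.
  by case: (nb k y \in cball x r) => //=; rewrite orbF /thin Mk /= negbK.
rewrite big_split /=; apply: leq_add.
  apply: (@leq_trans (\sum_(k : dir n)
     cnt (cball x r) (fun z => vbd (cpart M) z && ~~ cpart M (nb k z)))%N).
    rewrite [leqRHS](reindex_inj (can_inj (@opp_dirK n))) /=; apply: leq_sum => k _.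
    apply: (@leq_cnt_inj _ _ _ _ _ _ (nb k)) => [y|y z _ _ _ _]; last exact: nb_inj.
    rewrite inA => /and3P[yB My Cy] /andP[nB Cn]; rewrite nB nbK Cy andbT /= /vbd Cn /=.
    by apply/existsP; exists (opp_dir k); rewrite nbK.
  under eq_bigr do rewrite cnt_sum.
  rewrite exchange_big cnt_sum big_distrr /=; apply: leq_sum => z _.
  have [Vz|_] := boolP (vbd (cpart M) z); last by rewrite big1.
  by rewrite muln1; case/andP: Vz => Cz _; apply: cpart_neighbors.
apply: leq_sum => k _; apply: (@leq_cnt_inj _ _ _ _ _ _ id) => // y.
rewrite inA => /andP[yB ->] nB; rewrite andbT; move: y yB nB.
suff key (y : zlat n) : y \in cball x r -> nb k y \notin cball x r ->
    y \in level k.1 (setc k.1 (x 0 k.1 + sg k.2 * r%:Z) x) r 0 by exact: key.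
move=> yB; rewrite nb_line setc_cball // => nB.
have yk : y 0 k.1 = x 0 k.1 + sg k.2 * r%:Z.
  move/in_ball: yB => /(_ k.1); move: nB.
  by clear; case: k.2; rewrite /sg; lia.
apply/in_level; rewrite setcE eqxx yk addr0; split=> // j jk.
by rewrite setcE (negPf jk); move/in_ball: yB; apply.
Qed.

Lemma vbd_split n (M : pred (zlat n)) (B : {fset zlat n}) :
  (cnt B (vbd M) <= cnt B (vbd (cpart M)) + cnt B (fun y => thin M y && vbd M y))%N.
Proof.
apply: cntU => y _ Vy; have /andP[My /existsP[k kM]] := Vy.
rewrite Vy andbT -implyNb; apply/implyP => nC; rewrite /thin My /=.
apply: contra nC => Cy; rewrite /vbd Cy /=; apply/existsP; exists k.
by apply: contra kM => /cpart_sub.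
Qed.

Lemma boundary_ratio n : (0 < n)%N -> exists r0, forall (M : pred (zlat n)) x r,
  flip_minimal M -> M x -> (r0 <= r)%N ->
  (cnt (cball x r) (vbd M) <= (1 + 2 * n) * cnt (cball x r) (vbd (cpart M)))%N.
Proof.
move=> n0; have [G G0 grow] := volume_growth n.
pose K := (3 ^ n * (16 * n) * (2 ^ n.+1 * n * (2 * n)))%N; pose C1 := (2 * K)%N.
pose C2 := ((2 * C1) ^ n * (G * 2 ^ n * (4 * n * n)))%N.
have [r1 plane] := thin_plane n (6 * n * C2).
have K0 : (0 < K)%N by rewrite !muln_gt0 !expn_gt0 n0.
have C10 : (0 < C1)%N by rewrite muln_gt0.
have C20 : (0 < C2)%N.
  rewrite /C2 muln_gt0 expn_gt0 [(0 < 2 * C1)%N](muln_gt0 2 C1) C10 /=.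
  by rewrite !muln_gt0 expn_gt0 G0 n0.
exists (r1 + C1 + 3)%N => M x r Mf Mx rr.
set a := cnt _ (vbd M); set b := cnt _ (vbd (cpart M)).
set N := (2 * r).+1; set T := hole M x r.
have hE := inner_edges_hole M x r; rewrite -/a -/T in hE.
have hab := vbd_split M (cball x r); rewrite -/a -/b in hab.
have TB : {subset T <= cball x r} by move=> y; rewrite in_hole => /andP[].
pose s := (N %/ C1)%N.
have sN : (s * C1 <= N)%N by apply: leq_trunc_div.
have s0 : (0 < s)%N by rewrite divn_gt0 //; move: rr; clear; lia.
have Ns : (N <= 2 * C1 * s)%N.
  by have := ltn_ceil N C10; rewrite -/s; move: s0 C10; clear; nia.
(* Small hole: isoperimetry at scale s and [thin_hole_count] at depth r - 1 leave at most a / 2 thin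
   points; [C1] is chosen for this. *)
have [small|big] := leqP (2 * #|` T|) (s ^ n).
  have iso : (#|` T| <= 2 ^ n.+1 * n * s * inner_edges (cball x r) T)%N.
    by apply: (isoperimetry TB small); rewrite s0; apply: leq_div.
  have th := @thin_hole_count n M x r r.-1 Mf _.
  have {}th := th _; move: th => /(_ _)/wrap[|th]; first by move: rr; clear; lia.
  have h1 : (#|` T| <= (2 ^ n.+1 * n * (2 * n)) * (s * a))%N.
    apply: (leq_trans iso); rewrite -(mulnA _ s) -[leqRHS]mulnA leq_mul2l; apply/orP; right.
    by rewrite [leqRHS]mulnCA leq_mul2l hE orbT.
  set t := cnt _ (thin M) in th.
  have h2 : (2 * t * N <= a * N)%N.
    apply: (@leq_trans (2 * (4 * (t * r.-1)))%N); first by move: rr; rewrite /N; clear; nia.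
    apply: (@leq_trans (2 * (4 * (3 ^ n * (4 * n) * #|` T|)))%N); first by rewrite !leq_mul2l th.
    apply: (@leq_trans (C1 * (s * a))%N).
      rewrite /C1 /K; move: h1 th; clear.
      move: (2 ^ n.+1 * n * (2 * n))%N (s * a)%N #|` T| (3 ^ n)%N => c sa u d h1 _.
      apply: (@leq_trans (2 * (4 * (d * (4 * n) * (c * sa))))%N); first by rewrite !leq_mul2l h1 !orbT.
      by rewrite -!mulnA; clear; lia.
    by rewrite mulnA [(C1 * s)%N]mulnC [leqRHS]mulnC leq_mul2r sN orbT.
  rewrite leq_pmul2r // in h2.
  have h3 : (cnt (cball x r) (fun y => thin M y && vbd M y) <= t)%N.
    by apply: leq_cnt => y _ /andP[].
  have h4 : (a <= 2 * b)%N by move: hab h2 h3; clear; lia.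
  apply: (leq_trans h4); rewrite leq_mul2r; apply/orP; right; move: n0; clear; lia.
(* Large hole: at scale N every window centred in the hole contains all of [M] in the ball, so the
   boundary is at least of order N^(n-1). *)
have NC2 : (N ^ n.-1 <= C2 * a)%N.
  have rel := @relative_isoperimetry n _ _ T N (vol M x r) TB.
  move: rel => /(_ _)/wrap[z zT|rel].
    apply: leq_cnt => y yB My; rewrite in_hole yB My /=; apply/in_window => i.
    move/in_ball: yB => /(_ i); have /in_ball/(_ i) := TB _ zT.
    by rewrite /N; clear; lia.
  rewrite -/(cube _ _) -/(cball x r) in rel.
  have gr := grow M x r Mf Mx; rewrite -/N in gr.
  have Nn : (N ^ n = N * N ^ n.-1)%N by rewrite -expnS prednK.
  have NN0 : (0 < N ^ n)%N by rewrite expn_gt0.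
  have h1 : (#|` T| <= G * 2 ^ n * (2 * n * n) * (N * a))%N.
    rewrite -(leq_pmul2l NN0); apply: (@leq_trans (G * (#|` T| * vol M x r))%N).
      by rewrite mulnCA [leqLHS]mulnC leq_mul2l gr orbT.
    apply: (@leq_trans (G * ((2 * N) ^ n * (n * N * (2 * n * a))))%N).
      by rewrite leq_mul2l (leq_trans rel) ?orbT // !leq_mul2l hE !orbT.
    rewrite expnMn; move: (N ^ n)%N (2 ^ n)%N => u v; clear; nia.
  have h2 : (N ^ n <= (2 * C1) ^ n * (2 * #|` T|))%N.
    apply: leq_trans (leq_expnl n Ns) _; rewrite expnMn leq_mul2l; apply/orP; right.
    exact: ltnW.
  have h3 : (N * N ^ n.-1 <= N * (C2 * a))%N.
    rewrite -Nn; apply: (leq_trans h2); rewrite /C2; move: h1; clear.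
    move: ((2 * C1) ^ n)%N (2 ^ n)%N #|` T| => u v t h.
    apply: (@leq_trans (u * (2 * (G * v * (2 * n * n) * (N * a))))%N); first by rewrite !leq_mul2l h !orbT.
    by clear; nia.
  by rewrite leq_pmul2l in h3.
have th := thin_boundary x r Mf; rewrite -/b in th.
set F := (\sum_(k : dir n) _)%N in th.
(* Each of the 2 n faces carries at most N^(n-1) / (6 n C2) thin points. *)
have hF : (6 * n * C2 * F <= 2 * n * (C2 * a))%N.
  rewrite /F big_distrr /=; apply: (@leq_trans (\sum_(k : dir n) C2 * a)%N).
    apply: leq_sum => k _; apply: leq_trans NC2; apply: plane => //.
    by move: rr; clear; lia.
  by rewrite sum_nat_const card_prod card_ord card_bool [(n * 2)%N]mulnC.
have hF2 : (3 * F <= a)%N.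
  have nC : (0 < 2 * n * C2)%N by rewrite muln_gt0 C20 andbT muln_gt0 n0.
  by rewrite -(leq_pmul2l nC); move: hF; clear; nia.
(* From a <= (1 + n) b + F and 3 F <= a follows 2 a <= 3 (1 + n) b, which suffices as n >= 1. *)
by move: hab th hF2 n0; clear; nia.
Qed.

(** * The theorem *)

Lemma gdist_norm1 n (x y : zlat n) : (gdist x y <= norm1 (y - x)%R)%N.
Proof.
rewrite /gdist; case: ex_minnP => d _; apply; apply/asboolP.
have [v vE] : exists v : zlat n, v = y - x by exists (y - x).
have -> : y = x + v by rewrite vE addrC subrK.
rewrite addrAC subrr add0r; clear.
have [m] : exists m, norm1 v = m by exists (norm1 v).
elim: m v => [|m IHm] v vm.
  exists [::]; split=> //=; apply/rowP => i; rewrite zaddE.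
  move/eqP: vm; rewrite /norm1 sum_nat_eq0 => /forallP /(_ i) /=.
  by rewrite absz_eq0 => /eqP ->; rewrite addr0.
have [v' [k [v'm vE _]]] := norm1_step vm.
have [p [pp pl ps]] := IHm v' v'm.
exists (rcons p (x + v)); rewrite rcons_path last_rcons size_rcons pp pl ps v'm vm; split=> //=.
by apply/adjP; exists k; rewrite vE; apply/rowP => j; rewrite nbE !zaddE nbE addrA.
Qed.

Lemma norm1_cball n (x y : zlat n) r : y \in cball x r -> (norm1 (y - x)%R <= n * r)%N.
Proof.
move=> /in_ball yr; have -> : (n * r = \sum_(i < n) r)%N by rewrite sum_nat_const card_ord.
by apply: leq_sum => i _; have := yr i; rewrite zaddE zoppE; clear; lia.
Qed.

Lemma cube_ball_cball (R : realType) n (x y : zlat n) (r : R) : 0 <= r ->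
  cube_ball r x y <-> y \in cball x (Num.truncn r).
Proof.
move=> r0; rewrite /cube_ball /= -truncn_ge_nat //; split.
  by move=> /bigmax_leqP h; apply/in_ball => i; have := h i isT; clear; lia.
by move=> /in_ball h; apply/bigmax_leqP => i _; have := h i; clear; lia.
Qed.

Lemma set_card_cube_ball (R : realType) n (W : set (zlat n)) (P : pred (zlat n)) (x : zlat n) (r : R) :
  0 <= r -> (forall y, W y <-> P y) ->
  set_card (W `&` cube_ball r x) = cnt (cball x (Num.truncn r)) P.
Proof.
move=> r0 WP; rewrite /set_card.
have -> : W `&` cube_ball r x = [set` [fset y in cball x (Num.truncn r) | P y]%fset].
  apply/seteqP; split=> y /=; rewrite in_cnt.
    by move=> [/WP -> /(cube_ball_cball _ _ r0) ->].
  by move=> /andP[/(cube_ball_cball _ _ r0) ? /WP].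
by rewrite set_fsetK.
Qed.

Definition pred_of_set n (M : set (zlat n)) : pred (zlat n) := fun x => `[< M x >].

Lemma pred_of_setE n (M : set (zlat n)) x : M x <-> pred_of_set M x.
Proof. by split=> /asboolP. Qed.

Lemma cube_partE n (M : set (zlat n)) x : cube_part M x <-> cpart (pred_of_set M) x.
Proof.
rewrite /cpart; have -> : [set y | pred_of_set M y] = M.
  by apply/seteqP; split=> y /=; rewrite -pred_of_setE.
by split=> /asboolP.
Qed.

Lemma vertex_bdE n (W : set (zlat n)) (P : pred (zlat n)) : (forall y, W y <-> P y) ->
  forall x, vertex_bd W x <-> vbd P x.
Proof.
move=> WP x; split=> [[/WP Px [y Wy /adjP[k yk]]]|/andP[/WP Wx /existsP[k kP]]].
  by apply/andP; split=> //; apply/existsP; exists k; rewrite -yk; apply/negP => /WP.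
by split=> //; exists (nb k x); [move/WP; apply/negP | apply/adjP; exists k].
Qed.

(** In dimension 0 the lattice is a single point and has no proper nonempty subset. *)
Lemma minimal_dim n (M : set (zlat n)) : minimal M -> (0 < n)%N.
Proof.
case: n M => // M [[x Mx] MT _]; exfalso; apply: MT; apply/seteqP; split=> // y _.
by have -> : y = x by apply/rowP => -[].
Qed.

Theorem theorem1p11 (R : realType) (n : nat) :
  (forall M : set (zlat n), minimal M ->
    [/\ rough_isometry (@induced_dist R n (cube_part M)) (@induced_dist R n M)
          (@cube_part_incl n M),
        (forall x y : cube_part M,
          @induced_dist R n M (cube_part_incl x) (cube_part_incl y) =
          @induced_dist R n (cube_part M) x y) &
        exists2 c : R, 0 < c &
          forall x, M x -> (gdist_set R x (cube_part M) <= c%:E)%E]) /\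
  (exists2 cn : R, 0 < cn &
    forall M : set (zlat n), minimal M ->
    exists r0 : R, forall r : R, r0 <= r -> forall x, M x ->
      cn <= (set_card (cube_part M `&` cube_ball r x))%:R
            / (set_card (M `&` cube_ball r x))%:R /\
      (vertex_bd M `&` cube_ball r x !=set0 ->
       1 / (1 + 2 * n%:R) <=
         (set_card (vertex_bd (cube_part M) `&` cube_ball r x))%:R
         / (set_card (vertex_bd M `&` cube_ball r x))%:R :> R)).
Proof.
split.
  move=> M Mmin; have Mf := minimal_flip Mmin; have n0 := minimal_dim Mmin.
  have [r1 dense] := thin_sparse n0.
  (* At radius [r1] at least half of the points of [M] in the ball are in the cube part, hence at
     least one. *)
  have near x : M x -> exists2 y, cube_part M y & (gdist x y <= n * r1)%N.
    move=> /pred_of_setE Mx; have := dense _ x r1 Mf Mx (leqnn _).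
    have := vol_gt0 r1 Mx => V0 V1.
    have : (0 < cnt (cball x r1) (cpart (pred_of_set M)))%N.
      by move: V0 V1; rewrite -/(pred_of_set M); clear; lia.
    rewrite cardfs_gt0 => /fset0Pn[y]; rewrite in_cnt => /andP[yx /cube_partE Cy].
    by exists y => //; apply: leq_trans (gdist_norm1 x y) (norm1_cball yx).
  have c0 : 0 < (n * r1).+1%:R :> R by rewrite ltr0n.
  split=> //.
    exists 1, 0, (n * r1).+1%:R; split=> //.
      by move=> x x'; rewrite invr1 !mul1r subr0 addr0 lexx.
    move=> y; have [z Cz yz] := near _ (set_valP y).
    exists (exist _ z (mem_set Cz)); rewrite /induced_dist /= ler_nat.
    exact: leq_trans yz (leqnSn _).
  exists (n * r1).+1%:R => // x Mx; have [z Cz xz] := near x Mx.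
  apply: le_trans (ereal_inf_lbound _) _; first by exists z.
  by rewrite lee_fin ler_nat (leq_trans xz).
(* The density bound of [thin_sparse] is one half in every dimension. *)
exists (1 / 2) => [|M Mmin]; first by rewrite divr_gt0.
have Mf : flip_minimal (pred_of_set M) := minimal_flip Mmin.
have n0 := minimal_dim Mmin.
have [r1 dense] := thin_sparse n0; have [r2 bdry] := boundary_ratio n0.
exists (maxn r1 r2)%:R => r rr x Mx.
have r_ge0 : 0 <= r by apply: le_trans rr; rewrite ler0n.
have rt : (maxn r1 r2 <= Num.truncn r)%N by rewrite truncn_ge_nat.
rewrite geq_max in rt; case/andP: rt => rt1 rt2.
have Px : pred_of_set M x by apply/pred_of_setE.
rewrite (set_card_cube_ball x r_ge0 (cube_partE M)) (set_card_cube_ball x r_ge0 (pred_of_setE M)).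
rewrite (set_card_cube_ball x r_ge0 (vertex_bdE (cube_partE M))).
rewrite (set_card_cube_ball x r_ge0 (vertex_bdE (pred_of_setE M))).
split.
  rewrite ler_pdivlMr ?ltr0n; last exact: vol_gt0.
  rewrite mul1r mulrC ler_pdivrMr // -natrM ler_nat mulnC.
  exact: dense.
move=> [y [/(vertex_bdE (pred_of_setE M)) Vy /(cube_ball_cball x y r_ge0) yr]].
(* The given boundary vertex makes the denominator positive. *)
rewrite ler_pdivlMr ?ltr0n; last by rewrite cardfs_gt0; apply/fset0Pn; exists y; rewrite in_cnt yr.
have h : 0 < 1 + 2 * n%:R :> R by rewrite ltr_pwDl // mulr_ge0.
rewrite mul1r mulrC ler_pdivrMr // mulrC -[1 + _](_ : (1 + 2 * n)%:R = _); last by rewrite natrD natrM.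
by rewrite -natrM ler_nat; apply: bdry.
Qed.
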